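(* Let $R$ be a semilocal essentially right duo ring such that $E(R_R)$ and $E((R/J(R))_R)$ are cyclic right $R$-modules. Then $R$ is right pseudo-Frobenius and satisfies the following conditions: (1) $J(R)=Z(R_R)=Z({}_RR)$. (2) $\mathrm{soc}(R_R)=\mathrm{soc}({}_RR)$ (denote this common ideal by $\mathrm{soc}(R)$). (3) $\mathrm{soc}(R)$ is essential in $R_R$ and essential in ${}_RR$. (4) For every local idempotent $e$ of $R$, $\mathrm{soc}(eR)$ and $\mathrm{soc}(Re)$ are simple, $\mathrm{soc}(eR)$ is essential in $eR$ (as right modules), and $\mathrm{soc}(Re)$ is essential in $Re$ (as left modules). (5) $R$ has finite left Goldie dimension and finite right Goldie dimension. (6) Every simple right $R$-module embeds in $R_R$ and every simple left $R$-module embeds in ${}_RR$. (7) $R$ is a right $q$-ring. (8) $T=r_R(l_R(T))$ for every right ideal $T$ of $R$.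
   Context: Rings are associative with unity and modules are unitary. $E(M)$ is the injective hull of $M$, $J(R)$ the Jacobson radical, $\mathrm{soc}$ the socle, $Z(R_R)$ and $Z({}_RR)$ the right and left singular ideals; $r_R(X)$ and $l_R(X)$ are the right and left annihilators of $X$ in $R$. $R$ is semilocal if $R/J(R)$ is semisimple Artinian. $R$ is essentially right duo if every essential right ideal of $R$ is a two-sided ideal. $R$ is right pseudo-Frobenius if $R_R$ is an injective cogenerator in the category of right $R$-modules; equivalently, $R$ is a semiperfect right self-injective ring with essential right socle. An idempotent $e$ is local if $eRe$ is a local ring. $R$ is a right $q$-ring if every right ideal of $R$ is a quasi-injective right $R$-module. *)

(* Defs.v *)
From HB Require Import structures.
From mathcomp Require Import all_boot all_algebra generic_quotient ring_quotient.
From mathcomp Require Import boolp classical_sets.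

Set Implicit Arguments.
Unset Strict Implicit.
Unset Printing Implicit Defensive.

Import GRing.Theory.

Local Open Scope classical_set_scope.
Local Open Scope ring_scope.
Local Open Scope quotient_scope.

(* Rings are [pzRingType], i.e. associative unital rings, the zero ring being
   allowed.  A left R-module is an [lmodType R]; a right R-module is a left
   module over the opposite ring, i.e. an [lmodType R^c].  Module-theoretic
   notions are defined once, for left modules over a ring [A], and are used on
   the right with [A := R^c].  Submodules are classical subsets, so that left
   and right ideals of R are all of type [set R]. *)
Notation "R %:left_mod" := (GRing.regular R)
  (at level 2, only parsing) : type_scope.

(* R_R: [a *: x] is [x * a], since [*] is reversed in [R^c]. *)
Notation "R %:right_mod" := (GRing.regular (GRing.converse R))
  (at level 2, only parsing) : type_scope.

Section Submodules.
Variables (A : pzRingType) (M : lmodType A).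
Implicit Types (N K L X : set M).

Definition submodule N : Prop :=
  N 0 /\ forall (a : A) x y, N x -> N y -> N (a *: x + y).

Definition essential_in N K : Prop :=
  [/\ submodule N, submodule K, N `<=` K &
      forall L, submodule L -> L `<=` K -> L `&` N = [set 0] -> L = [set 0]].

Definition simple_submodule N : Prop :=
  [/\ submodule N, N <> [set 0] &
      forall L, submodule L -> L `<=` N -> L = [set 0] \/ L = N].

Definition maximal_submodule N : Prop :=
  [/\ submodule N, N <> setT &
      forall L, submodule L -> N `<=` L -> L = N \/ L = setT].

Definition submodule_sum (F : set (set M)) : set M :=
  smallest submodule (\bigcup_(N in F) N).

Definition socle K : set M :=
  submodule_sum [set N | simple_submodule N /\ N `<=` K].

Definition independent (N : nat -> set M) : Prop :=
  forall (n : nat) (x : nat -> M), (forall i, N i (x i)) ->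
    \sum_(i < n) x i = 0 -> forall i, (i < n)%N -> x i = 0.

End Submodules.

Section Modules.
Variable A : pzRingType.

Definition simple_module (M : lmodType A) : Prop :=
  simple_submodule [set: M].

Definition semisimple_module (M : lmodType A) : Prop :=
  socle [set: M] = [set: M].

Definition artinian_module (M : lmodType A) : Prop :=
  forall N : nat -> set M,
    (forall i, submodule (N i)) -> (forall i, N i.+1 `<=` N i) ->
    exists n, forall m, (n <= m)%N -> N m = N n.

Definition cyclic_module (M : lmodType A) : Prop :=
  exists x : M, forall y : M, exists a : A, y = a *: x.

Definition embeds (M M' : lmodType A) : Prop :=
  exists f : {linear M -> M'}, injective f.

(* No infinite direct sum of nonzero submodules. *)
Definition finite_goldie_dim (M : lmodType A) : Prop :=
  ~ exists N : nat -> set M,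
      (forall i, submodule (N i) /\ N i <> [set 0]) /\ independent N.

Definition injective_module (Q : lmodType A) : Prop :=
  forall (M M' : lmodType A) (i : {linear M -> M'}) (f : {linear M -> Q}),
    injective i -> exists g : {linear M' -> Q}, forall x, g (i x) = f x.

(* Linear maps into Q from a submodule of Q (given up to isomorphism by an
   embedding i) extend to Q. *)
Definition quasi_injective (Q : lmodType A) : Prop :=
  forall (M : lmodType A) (i : {linear M -> Q}) (f : {linear M -> Q}),
    injective i -> exists g : {linear Q -> Q}, forall x, g (i x) = f x.

(* The categorical notion: C separates parallel morphisms. *)
Definition cogenerator (C : lmodType A) : Prop :=
  forall (M M' : lmodType A) (f g : {linear M -> M'}),
    (exists x, f x <> g x) ->
    exists h : {linear M' -> C}, exists x, h (f x) <> h (g x).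

Definition injective_hull (M E : lmodType A) (i : {linear M -> E}) : Prop :=
  [/\ injective_module E, injective i & essential_in (range i) [set: E]].

(* "E(M) is cyclic"; as E(M) is unique up to isomorphism over M, it does not
   matter which injective hull is taken. *)
Definition cyclic_injective_hull (M : lmodType A) : Prop :=
  exists (E : lmodType A) (i : {linear M -> E}),
    injective_hull i /\ cyclic_module E.

End Modules.

Section SubQuotientModule.
Variables (A : pzRingType) (M : lmodType A) (N : set M) (HN : submodule N).

Definition submod_pred & submodule N : {pred M} := [pred x | x \in N].

Lemma submod_pred_closed : submod_closed (submod_pred HN).
Proof.
case: (HN) => N0 NL; split=> [|a x y]; rewrite !inE //; exact: NL.
Qed.

HB.instance Definition _ :=
  GRing.isSubmodClosed.Build A M (submod_pred HN) submod_pred_closed.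

Inductive submod_of : predArgType := Submod x & x \in submod_pred HN.

Definition submod_val (u : submod_of) : M := let: Submod x _ := u in x.

HB.instance Definition _ := [isSub of submod_of for submod_val].
HB.instance Definition _ := [Choice of submod_of by <:].
HB.instance Definition _ := [SubChoice_isSubZmodule of submod_of by <:].
HB.instance Definition _ := [SubZmodule_isSubLmodule of submod_of by <:].

Local Notation qM := (Quotient.quot (submod_pred HN)).

Definition quot_mod : Type := qM.

HB.instance Definition _ := GRing.Zmodule.on quot_mod.

Definition quot_scale (a : A) (u : quot_mod) : quot_mod :=
  \pi_qM (a *: repr u).

Lemma pi_quot_scale a x : quot_scale a (\pi_qM x) = \pi_qM (a *: x).
Proof.
apply/eqP; rewrite -Quotient.idealrBE -scalerBr rpredZ //.
by rewrite Quotient.idealrBE reprK.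
Qed.

Lemma pi_quot_add x y : \pi_qM x + \pi_qM y = \pi_qM (x + y) :> quot_mod.
Proof. exact: (esym (raddfD (\pi_qM) x y)). Qed.

Fact quot_scalerA a b u :
  quot_scale a (quot_scale b u) = quot_scale (a * b) u.
Proof.
by elim/quotW: u => x; rewrite (pi_quot_scale b x) !pi_quot_scale scalerA.
Qed.

Fact quot_scale1r : left_id 1 quot_scale.
Proof. by elim/quotW => x; rewrite pi_quot_scale scale1r. Qed.

Fact quot_scalerDr : right_distributive quot_scale +%R.
Proof.
move=> a; elim/quotW=> x; elim/quotW=> y.
by rewrite (pi_quot_scale a x) (pi_quot_scale a y) !pi_quot_add pi_quot_scale
  scalerDr.
Qed.

Fact quot_scalerDl u : {morph quot_scale^~ u : a b / a + b}.
Proof.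
by elim/quotW: u => x a b; rewrite !pi_quot_scale pi_quot_add scalerDl.
Qed.

HB.instance Definition _ := GRing.Zmodule_isLmodule.Build A quot_mod
  quot_scalerA quot_scale1r quot_scalerDr quot_scalerDl.

End SubQuotientModule.

Section Ideals.
Variable R : pzRingType.

Definition left_ideal (I : set R) : Prop := submodule (I : set R%:left_mod).

Definition right_ideal (I : set R) : Prop := submodule (I : set R%:right_mod).

Definition two_sided_ideal (I : set R) : Prop := left_ideal I /\ right_ideal I.

Definition maximal_right_ideal (I : set R) : Prop :=
  maximal_submodule (I : set R%:right_mod).

Definition essential_right_ideal (I : set R) : Prop :=
  essential_in (I : set R%:right_mod) setT.

Definition essential_left_ideal (I : set R) : Prop :=
  essential_in (I : set R%:left_mod) setT.

(* For the zero ring there is no maximal right ideal and J(R) = R. *)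
Definition jacobson : set R := \bigcap_(I in maximal_right_ideal) I.

Definition right_ann (X : set R) : set R :=
  [set a | forall x, X x -> x * a = 0].

Definition left_ann (X : set R) : set R :=
  [set a | forall x, X x -> a * x = 0].

Definition right_singular : set R :=
  [set x | essential_right_ideal (right_ann [set x])].

Definition left_singular : set R :=
  [set x | essential_left_ideal (left_ann [set x])].

Definition right_socle (I : set R) : set R := socle (I : set R%:right_mod).

Definition left_socle (I : set R) : set R := socle (I : set R%:left_mod).

Lemma right_ideal_jacobson : right_ideal jacobson.
Proof.
split=> [I [[]] //|a x y Jx Jy I maxI].
by case: (maxI) => -[_ IL] _ _; apply: IL; [apply: Jx|apply: Jy].
Qed.

Lemma left_ideal_jacobson : left_ideal jacobson.
Proof.
split=> [I [[]] //|a x y Jx Jy I maxI].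
case: (maxI) => -[I0 IL] InT Imax.
suff Iax : I (a * x).
  by have := IL 1 (a * x) y Iax (Jy I maxI); rewrite scale1r.
pose K : set R := [set z | I (a * z)].
have rK : right_ideal K.
  split=> [|b u v Ku Kv]; first by rewrite /K /= mulr0.
  change (I (a * ((u : R) * (b : R) + (v : R)))); rewrite mulrDr mulrA.
  exact: (IL b (a * u) (a * v) Ku Kv).
have [KT|KnT] := pselect (K = setT).
  by have : K x by rewrite KT.
apply: (Jx K); split=> // L [L0 LL] KL.
have [LK|] := pselect (L `<=` K); first by left; apply/seteqP.
move=> /existsNP[z /not_implyP[Lz nKz]]; right.
pose P : set R := [set w | exists2 i, I i & exists r, w = i + a * z * r].
have rP : right_ideal P.
  split; first by exists 0 => //; exists 0; rewrite mulr0 addr0.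
  move=> b _ _ [i Ii [r ->]] [j Ij [s ->]].
  exists (i * (b : R) + j); first exact: (IL b).
  exists (r * (b : R) + s).
  change ((i + a * z * r) * (b : R) + (j + a * z * s) =
    i * (b : R) + j + a * z * (r * (b : R) + s)).
  by rewrite mulrDl mulrDr !mulrA addrACA.
have IP : I `<=` P by move=> i Ii; exists i => //; exists 0; rewrite mulr0 addr0.
have [PI|PT] := Imax P rP IP.
  case: nKz; rewrite /K /= -PI; exists 0 => //; exists 1.
  by rewrite add0r mulr1.
have [i Ii [r ar]] : P a by rewrite PT.
have L1r : L (1 - (z : R) * r).
  apply: KL; suff -> : K (1 - (z : R) * r) = I i by [].
  by rewrite /K /= mulrBr mulr1 mulrA; congr I; apply/eqP; rewrite subr_eq -ar.
have L1 : L 1.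
  by have := LL r z _ Lz L1r; rewrite [_ *: _]/((z : R) * r) addrC subrK.
apply/seteqP; split=> // w _.
have : L ((1 : R) * (w : R) + (0 : R)) by exact: (LL w 1 0 L1 L0).
by rewrite mul1r addr0.
Qed.

Lemma two_sided_ideal_jacobson : two_sided_ideal jacobson.
Proof. by split; [apply: left_ideal_jacobson|apply: right_ideal_jacobson]. Qed.

End Ideals.

Arguments jacobson : clear implicits.
Arguments right_singular : clear implicits.
Arguments left_singular : clear implicits.

Section QuotientRing.
Variables (R : pzRingType) (I : set R) (HI : two_sided_ideal I).

Local Notation qR := (Quotient.quot (submod_pred HI.2)).

Definition quot_ring : Type := qR.

HB.instance Definition _ := GRing.Zmodule.on quot_ring.

Definition quot_one : quot_ring := \pi_qR (1 : R).

Definition quot_mul (u v : quot_ring) : quot_ring :=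
  \pi_qR ((repr u : R) * (repr v : R)).

Lemma pi_quot_mul (x y : R) :
  quot_mul (\pi_qR x) (\pi_qR y) = \pi_qR (x * y).
Proof.
have piI (z : R) : I ((repr (\pi_qR z) : R) - z).
  have : repr (\pi_qR z) - z \in submod_pred HI.2.
    by rewrite Quotient.idealrBE reprK.
  by rewrite !inE.
have [[_ IL] [I0 IR]] := HI.
apply/eqP; rewrite -Quotient.idealrBE; apply/mem_set.
pose x' : R := repr (\pi_qR x); pose y' : R := repr (\pi_qR y).
have Ix : I ((x' - x) * y' + 0) by exact: (IR y' (x' - x) 0 (piI x) I0).
have : I (x * (y' - y) + ((x' - x) * y' + 0)).
  exact: (IL x (y' - y) _ (piI y) Ix).
by rewrite addr0 mulrBr mulrBl addrC addrA subrK.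
Qed.

Lemma pi_quot_ring_add (x y : R) :
  \pi_qR x + \pi_qR y = \pi_qR (x + y) :> quot_ring.
Proof. exact: (esym (raddfD (\pi_qR) x y)). Qed.

Fact quot_mulA : associative quot_mul.
Proof.
elim/quotW=> x; elim/quotW=> y; elim/quotW=> z.
by rewrite (pi_quot_mul y z) (pi_quot_mul x y) !pi_quot_mul mulrA.
Qed.

Fact quot_mul1r : left_id quot_one quot_mul.
Proof. by elim/quotW=> x; rewrite pi_quot_mul mul1r. Qed.

Fact quot_mulr1 : right_id quot_one quot_mul.
Proof. by elim/quotW=> x; rewrite pi_quot_mul mulr1. Qed.

Fact quot_mulDl : left_distributive quot_mul +%R.
Proof.
elim/quotW=> x; elim/quotW=> y; elim/quotW=> z.
by rewrite (pi_quot_mul x z) (pi_quot_mul y z) !pi_quot_ring_add pi_quot_mul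
  mulrDl.
Qed.

Fact quot_mulDr : right_distributive quot_mul +%R.
Proof.
elim/quotW=> x; elim/quotW=> y; elim/quotW=> z.
by rewrite (pi_quot_mul x y) (pi_quot_mul x z) !pi_quot_ring_add pi_quot_mul
  mulrDr.
Qed.

HB.instance Definition _ := GRing.Zmodule_isPzRing.Build quot_ring
  quot_mulA quot_mul1r quot_mulr1 quot_mulDl quot_mulDr.

End QuotientRing.

(* For an idempotent e, the ring eRe (with unit e) is {x | e x e = x}. *)
Section Corner.
Variables (R : pzRingType) (e : R) (He : e * e = e).

Definition corner_pred & e * e = e : {pred R} := [pred x | e * x * e == x].

Lemma corner_pred_zmod_closed : zmod_closed (corner_pred He).
Proof.
split=> [|x y]; rewrite !inE; first by rewrite mulr0 mul0r.
by move=> /eqP xe /eqP ye; rewrite mulrBr mulrBl xe ye.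
Qed.

HB.instance Definition _ :=
  GRing.isZmodClosed.Build R (corner_pred He) corner_pred_zmod_closed.

Inductive corner : predArgType := Corner x & x \in corner_pred He.

Definition corner_val (u : corner) : R := let: Corner x _ := u in x.

HB.instance Definition _ := [isSub of corner for corner_val].
HB.instance Definition _ := [Choice of corner by <:].
HB.instance Definition _ := [SubChoice_isSubZmodule of corner by <:].

Lemma corner_e (u : corner) : e * val u = val u /\ val u * e = val u.
Proof.
case: u => x /=; rewrite inE => /eqP xe; rewrite -xe.
by rewrite !mulrA He -!mulrA He.
Qed.

Lemma corner_one_subproof : e \in corner_pred He.
Proof. by rewrite inE !He. Qed.

Lemma corner_mul_subproof (u v : corner) : val u * val v \in corner_pred He.
Proof.
by rewrite inE mulrA (corner_e u).1 -mulrA (corner_e v).2.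
Qed.

Definition corner_one : corner := Corner corner_one_subproof.

Definition corner_mul (u v : corner) : corner :=
  Corner (corner_mul_subproof u v).

Fact corner_mulA : associative corner_mul.
Proof. by move=> u v w; apply/val_inj; rewrite /= mulrA. Qed.

Fact corner_mul1r : left_id corner_one corner_mul.
Proof. by move=> u; apply/val_inj/(corner_e u).1. Qed.

Fact corner_mulr1 : right_id corner_one corner_mul.
Proof. by move=> u; apply/val_inj/(corner_e u).2. Qed.

Fact corner_mulDl : left_distributive corner_mul +%R.
Proof. by move=> u v w; apply/val_inj; rewrite /= mulrDl. Qed.

Fact corner_mulDr : right_distributive corner_mul +%R.
Proof. by move=> u v w; apply/val_inj; rewrite /= mulrDr. Qed.

HB.instance Definition _ := GRing.Zmodule_isPzRing.Build corner
  corner_mulA corner_mul1r corner_mulr1 corner_mulDl corner_mulDr.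

End Corner.

Section RingProperties.
Variable R : pzRingType.

(* Either side may be used: a ring is semisimple as a right module over itself
   iff it is so as a left module (Wedderburn-Artin). *)
Definition semisimple_artinian : Prop :=
  semisimple_module R%:right_mod /\ artinian_module R%:right_mod.

Definition local_ring : Prop := exists! I : set R, maximal_right_ideal I.

Definition essentially_right_duo : Prop :=
  forall I : set R, essential_right_ideal I -> two_sided_ideal I.

Definition right_pseudo_frobenius : Prop :=
  injective_module R%:right_mod /\ cogenerator R%:right_mod.

Definition right_q_ring : Prop :=
  forall (I : set R) (HI : right_ideal I), quasi_injective (submod_of HI).

End RingProperties.

Definition semilocal (R : pzRingType) : Prop :=
  semisimple_artinian (quot_ring (two_sided_ideal_jacobson R)).

Definition quot_jacobson_right_mod (R : pzRingType) : lmodType R^c :=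
  quot_mod (right_ideal_jacobson R).

Definition local_idempotent (R : pzRingType) (e : R) : Prop :=
  exists He : e * e = e, local_ring (corner He).

Definition right_principal (R : pzRingType) (e : R) : set R :=
  range (fun a => e * a).

Definition left_principal (R : pzRingType) (e : R) : set R :=
  range (fun a => a * e).

(* Main.v *)
From HB Require Import structures.
Require Import Defs.
From mathcomp Require Import all_boot all_algebra generic_quotient ring_quotient.
From mathcomp Require Import boolp classical_sets.

(** The theorem splits into a reduction and a list of consequences.

   The reduction shows that R is right self-injective and that some element s0
   has right annihilator J = J(R) and generates an essential right ideal s0 R. In
   other words, R_R is injective and is the injective hull of a copy of R/J.

   Self-injectivity (self_injective_of_cyclic_hull) comes from R being semilocal
   and E(R) = xR being cyclic. Modulo xJ the module xR is Artinian, so that a split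
   monomorphism of E(R) into itself is onto. Writing the unit of R as xa, this
   applies to the extension to E(R) of left multiplication by a, and it forces the
   annihilator of x to be zero.

   Let now E(R/J) = yR, with T the right annihilator of y. The inclusion T <= J
   (generator_ann_sub_jacobson) is a count: E(R/J) is a direct sum of as many
   uniform summands as R/J has simple ones, each summand needs a generator, so
   E(R/J) modulo yJ cannot be shorter than R/J. The duo hypothesis gives
   (1 - e) R e J = 0 for every idempotent e (duo_idempotent). For an idempotent e with
   T + (1 - e) R essential in R and eT = T this makes T a two-sided ideal, which
   annihilates the faithful module E(R/J). Hence T = 0, and R is isomorphic to E(R/J)
   (jacobson_annihilator_essential).

   In the second part R is a self-injective ring with such an s0. Every
   maximal right ideal is then the right annihilator of an element of S = s0 R, and
   by self-injectivity b lies in Ra as soon as b kills the right annihilator of a.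
   These two facts turn right-hand information about S into left-hand information:
   S is both the right and the left socle, it is essential on both sides, and both
   of its annihilators are J. Chain conditions on R/J yield the finite Goldie dimensions
   and the embedding of simple left modules. A local idempotent admits only one maximal
   right ideal above 1 - e, which gives the statements about eR and Re. Finally, for a right
   ideal I with complement K the ideal I + K is two-sided, so that endomorphisms of R
   induce endomorphisms of I: this is the q-ring property. *)

Set Implicit Arguments.
Unset Strict Implicit.
Unset Printing Implicit Defensive.

Import GRing.Theory.

Local Open Scope classical_set_scope.
Local Open Scope ring_scope.
Local Open Scope quotient_scope.

(** * Submodules *)

Section SubmoduleTheory.
Variables (A : pzRingType) (M : lmodType A).
Implicit Types (N K L X : set M) (x y z : M) (a b : A).

Lemma submoduleP N :
  N 0 -> (forall x y, N x -> N y -> N (x + y)) ->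
  (forall a x, N x -> N (a *: x)) -> submodule N.
Proof. by move=> N0 ND NZ; split=> // a x y Nx Ny; apply: ND => //; apply: NZ. Qed.

Lemma submodule0 N : submodule N -> N 0.
Proof. by case. Qed.

Lemma submoduleD N x y : submodule N -> N x -> N y -> N (x + y).
Proof. by move=> [_ NL] Nx Ny; rewrite -[x]scale1r; apply: NL. Qed.

Lemma submoduleZ N a x : submodule N -> N x -> N (a *: x).
Proof. by move=> [N0 NL] Nx; rewrite -[_ *: _]addr0; apply: NL. Qed.

Lemma submoduleN N x : submodule N -> N x -> N (- x).
Proof. by move=> sN Nx; rewrite -scaleN1r; apply: submoduleZ. Qed.

Lemma submoduleB N x y : submodule N -> N x -> N y -> N (x - y).
Proof. by move=> sN Nx Ny; apply: submoduleD => //; apply: submoduleN. Qed.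

Lemma submodule_zero : submodule [set 0 : M].
Proof. by apply: submoduleP => // [x y -> ->|a x ->]; rewrite ?addr0 ?scaler0. Qed.

Lemma submodule_setT : submodule [set: M].
Proof. by []. Qed.

Lemma submoduleI N K : submodule N -> submodule K -> submodule (N `&` K).
Proof.
move=> sN sK; apply: submoduleP => [|x y [Nx Kx] [Ny Ky]|a x [Nx Kx]].
- by split; apply: submodule0.
- by split; apply: submoduleD.
- by split; apply: submoduleZ.
Qed.

Definition submod_add N K : set M :=
  [set z | exists2 x, N x & exists2 y, K y & z = x + y].

Lemma submodule_add N K : submodule N -> submodule K -> submodule (submod_add N K).
Proof.
move=> sN sK; apply: submoduleP.
- by exists 0; [apply: submodule0|exists 0; [apply: submodule0|rewrite addr0]].
- move=> _ _ [x Nx [y Ky ->]] [x' Nx' [y' Ky' ->]].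
  exists (x + x'); first exact: submoduleD.
  by exists (y + y'); [apply: submoduleD|rewrite addrACA].
- move=> a _ [x Nx [y Ky ->]].
  exists (a *: x); first exact: submoduleZ.
  by exists (a *: y); [apply: submoduleZ|rewrite scalerDr].
Qed.

Lemma submod_addl N K : submodule K -> N `<=` submod_add N K.
Proof. by move=> sK x Nx; exists x => //; exists 0; [apply: submodule0|rewrite addr0]. Qed.

Lemma submod_addr N K : submodule N -> K `<=` submod_add N K.
Proof. by move=> sN x Kx; exists 0; [apply: submodule0|exists x; rewrite ?add0r]. Qed.

Lemma submodule_cyclic x : submodule [set a *: x | a in [set: A]].
Proof.
apply: submoduleP; first by exists 0; rewrite ?scale0r.
- by move=> _ _ [a _ <-] [b _ <-]; exists (a + b); rewrite ?scalerDl.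
- by move=> c _ [a _ <-]; exists (c * a); rewrite ?scalerA.
Qed.

Lemma cyclic_sub N x : submodule N -> N x -> [set a *: x | a in [set: A]] `<=` N.
Proof. by move=> sN Nx _ [a _ <-]; apply: submoduleZ. Qed.

Lemma mem_cyclic x : [set a *: x | a in [set: A]] x.
Proof. by exists 1; rewrite ?scale1r. Qed.

Lemma nonzero_submodule N : submodule N -> N <> [set 0] -> exists2 x, N x & x <> 0.
Proof.
move=> sN N0; apply: contrapT => nex; apply: N0; apply/seteqP; split=> x /=.
  by move=> Nx; apply: contrapT => x0; apply: nex; exists x.
by move=> ->; apply: submodule0.
Qed.

Lemma essentialP N K : submodule N -> submodule K -> N `<=` K ->
  essential_in N K <->
  (forall x, K x -> x <> 0 -> exists2 a, N (a *: x) & a *: x <> 0).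
Proof.
move=> sN sK NK; split=> [[_ _ _ ess] x Kx x0|ess].
  pose L := [set a *: x | a in [set: A]].
  apply: contrapT => nex; apply: x0.
  suff : L = [set 0] by move=> L0; have := mem_cyclic x; rewrite -/L L0.
  apply: ess; [exact: submodule_cyclic|exact: cyclic_sub|].
  apply/seteqP; split=> [_ [[a _ <-] Nax]|_ ->] /=.
    by apply: contrapT => ax0; apply: nex; exists a.
  by split; [exact: (submodule0 (submodule_cyclic x))|apply: submodule0].
split=> // L sL LK LN; apply: contrapT => /(nonzero_submodule sL)[x Lx x0].
have [a Nax] := ess x (LK x Lx) x0; case.
suff : (L `&` N) (a *: x) by rewrite LN.
by split=> //; apply: submoduleZ.
Qed.

Lemma essential_sub N N' K : submodule N' -> essential_in N K -> N `<=` N' -> N' `<=` K ->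
  essential_in N' K.
Proof.
move=> sN' [sN sK NK ess] NN' N'K; split=> // L sL LK LN'; apply: ess => //.
apply/seteqP; split=> [x [Lx Nx]|_ ->]; last by split; apply: submodule0.
by rewrite -LN'; split=> //; apply: NN'.
Qed.

(** Zorn's lemma, in the form in which it yields complements (avoid the nonzero
   elements of a submodule) as well as maximal right ideals (avoid 1). *)
Lemma exists_maximal_avoiding N X : submodule N -> (forall x, N x -> ~ X x) ->
  exists K, [/\ submodule K, N `<=` K, (forall x, K x -> ~ X x) &
    forall L, submodule L -> K `<=` L -> (forall x, L x -> ~ X x) -> L = K].
Proof.
move=> sN NX.
(* Working with N joined to Y makes the union of the empty chain admissible. *)
pose P Y := submodule (N `|` Y) /\ (forall x, Y x -> ~ X x).
have [F FP Ftot|Y [[sNY YX] Ymax]] := @Zorn_bigcup M P.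
  split; last by move=> x [Y FY Yx]; apply: (FP _ FY).2.
  set U := N `|` _.
  have common x y : U x -> U y -> exists B, [/\ submodule B, B `<=` U, B x & B y].
    have sub Y : F Y -> N `|` Y `<=` U.
      by move=> FY z [Nz|Yz]; [left|right; exists Y].
    move=> [Nx|[Y FY Yx]] [Ny|[Z FZ Zy]].
    - by exists N; split=> //; apply: subsetUl.
    - by exists (N `|` Z); split; [exact: (FP _ FZ).1|exact: sub|left|right].
    - by exists (N `|` Y); split; [exact: (FP _ FY).1|exact: sub|right|left].
    have [YZ|ZY] := Ftot _ _ FY FZ.
      exists (N `|` Z); split; [exact: (FP _ FZ).1|exact: sub| |by right].
      by right; apply: YZ.
    exists (N `|` Y); split; [exact: (FP _ FY).1|exact: sub|by right|].
    by right; apply: ZY.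
  apply: submoduleP; first by left; apply: submodule0.
    move=> x y Ux Uy; have [B [sB BU Bx By]] := common x y Ux Uy.
    by apply: BU; apply: submoduleD.
  move=> a x Ux; have [B [sB BU Bx _]] := common x x Ux Ux.
  by apply: BU; apply: submoduleZ.
exists (N `|` Y); split; [exact: sNY|by move=> x; left|by move=> x [/NX|/YX]|].
move=> L sL NYL LX; apply: contrapT => LNY; apply: (Ymax L).
  split=> [x Yx|LY]; first by apply: NYL; right.
  by apply: LNY; apply/seteqP; split=> // x /LY Yx; right.
split=> //; suff -> : N `|` L = L by [].
by apply/setUidPr => x Nx; apply: NYL; left.
Qed.

Lemma exists_complement N : submodule N ->
  exists C, [/\ submodule C, (forall x, N x -> C x -> x = 0) &
    essential_in (submod_add N C) [set: M]].
Proof.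
move=> sN.
have [|C [sC _ CX Cmax]] := @exists_maximal_avoiding [set 0] [set x | N x /\ x <> 0]
  submodule_zero; first by move=> x -> [].
have NC x : N x -> C x -> x = 0.
  by move=> Nx Cx; apply: contrapT => x0; apply: CX Cx _.
exists C; split=> //; split=> //; first exact: submodule_add.
move=> L sL _ L0.
have LC : submod_add L C = C.
  apply: Cmax; [exact: submodule_add|exact: submod_addr|].
  move=> _ [l Ll [c Cc ->]] [Nlc]; apply; have l0 : l = 0.
    suff : (L `&` submod_add N C) l by rewrite L0.
    split=> //; exists (l + c) => //; exists (- c); first exact: submoduleN.
    by rewrite addrK.
  by rewrite l0 add0r in Nlc *; apply: NC.
apply/seteqP; split=> [l Ll|_ ->]; last exact: submodule0.
rewrite -L0; split=> //; apply: (submod_addr sN); rewrite -LC.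
exact: submod_addl.
Qed.

Lemma submodule_submodule_sum (F : set (set M)) : submodule (submodule_sum F).
Proof.
apply: submoduleP => [N [sN _]|x y Fx Fy N HN|a x Fx N HN]; first exact: submodule0.
  by apply: submoduleD (HN.1) _ _; [apply: Fx|apply: Fy].
by apply: submoduleZ (HN.1) _; apply: Fx.
Qed.

Lemma submodule_socle K : submodule (socle K).
Proof. exact: submodule_submodule_sum. Qed.

Lemma socle_min K N : submodule N ->
  (forall L, simple_submodule L -> L `<=` K -> L `<=` N) -> socle K `<=` N.
Proof. by move=> sN LN; apply: smallest_sub => // x [L [sL LK] Lx]; apply: LN LK _ Lx. Qed.

Lemma simple_sub_socle K L : simple_submodule L -> L `<=` K -> L `<=` socle K.
Proof. by move=> sL LK x Lx N [_]; apply; exists L. Qed.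

Lemma socle_sub K : submodule K -> socle K `<=` K.
Proof. by move=> sK; apply: socle_min. Qed.

Lemma simple_meet_sub L N : simple_submodule L -> submodule N ->
  (exists2 x, (L `&` N) x & x <> 0) -> L `<=` N.
Proof.
move=> [sL _ Lmin] sN [x LNx x0].
have [|LN0|LN] := Lmin (L `&` N) (submoduleI sL sN); first by move=> ? [].
  by rewrite LN0 in LNx.
by move=> y; rewrite -{1}LN => -[].
Qed.

Lemma simple_sub_eq L L' : simple_submodule L -> simple_submodule L' -> L `<=` L' -> L = L'.
Proof. by move=> [sL L0 _] [_ _ L'min] /(L'min _ sL)[]. Qed.

(** A simple submodule meets every essential one, hence lies in it. *)
Lemma socle_sub_essential N K : essential_in N K -> socle K `<=` N.
Proof.
move=> [sN sK NK ess]; apply: socle_min => // L simL LK.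
apply: simple_meet_sub => //; have [sL L0 _] := simL.
apply: nonzero_submodule; first exact: submoduleI.
by move=> /(ess _ sL LK).
Qed.

Lemma socle_essential K : submodule K ->
  (forall x, K x -> x <> 0 -> exists L, [/\ simple_submodule L, L `<=` K &
     exists2 a, L (a *: x) & a *: x <> 0]) -> essential_in (socle K) K.
Proof.
move=> sK HK; apply/essentialP => //; [exact: submodule_socle|exact: socle_sub|].
move=> x Kx /(HK x Kx)[L [simL LK [a Lax ax0]]]; exists a => //.
exact: simple_sub_socle Lax.
Qed.

Lemma simple_socle K L0 : simple_submodule L0 -> L0 `<=` K ->
  (forall L, simple_submodule L -> L `<=` K -> L = L0) -> simple_submodule (socle K).
Proof.
move=> simL0 L0K uniqL; suff -> : socle K = L0 by [].
apply/seteqP; split; last exact: simple_sub_socle.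
by apply: socle_min => [|L simL LK]; [case: simL0|rewrite (uniqL L)].
Qed.

End SubmoduleTheory.

Lemma submodule_ann (A : pzRingType) (M : lmodType A) (x : M) :
  submodule ([set a : A | a *: x = 0] : set (GRing.regular A)).
Proof.
apply: submoduleP => [|a b /= ax bx|a b /= bx]; first by rewrite /= scale0r.
  by rewrite scalerDl ax bx addr0.
by rewrite -scalerA bx scaler0.
Qed.

Lemma simple_disjoint_or_eq (A : pzRingType) (M : lmodType A) (L L' : set M) :
  simple_submodule L -> simple_submodule L' ->
  (forall x, L x -> L' x -> x = 0) \/ L = L'.
Proof.
move=> simL simL'; have [disj|nd] := pselect (forall x, L x -> L' x -> x = 0); [by left|right].
move: nd => /existsNP[x /not_implyP[Lx /not_implyP[L'x x0]]].
apply: (simple_sub_eq simL simL'); apply: (simple_meet_sub simL) => //.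
  by case: simL'.
by exists x.
Qed.

Section PartialSums.
Variables (A : pzRingType) (M : lmodType A) (N : nat -> set M).
Hypothesis sN : forall i, submodule (N i).

Definition partial_sum n : set M :=
  [set x | exists2 y : nat -> M, forall i, N i (y i) & x = \sum_(i < n) y i].

Lemma submodule_partial_sum n : submodule (partial_sum n).
Proof.
apply: submoduleP.
- exists (fun=> 0) => [i|]; first exact: submodule0.
  by rewrite big1.
- move=> _ _ [y Ny ->] [z Nz ->]; exists (fun i => y i + z i); last by rewrite big_split.
  by move=> i; apply: submoduleD.
- move=> a _ [y Ny ->]; exists (fun i => a *: y i); last by rewrite scaler_sumr.
  by move=> i; apply: submoduleZ.
Qed.

Lemma partial_sumS n x z : partial_sum n x -> N n z -> partial_sum n.+1 (x + z).
Proof.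
move=> [y Ny ->] Nz; exists (fun i => if i == n then z else y i).
  by move=> i; case: eqP => [->|_].
rewrite big_ord_recr /= eqxx; congr (_ + _); apply: eq_bigr => i _.
by rewrite ltn_eqF.
Qed.

Lemma mem_partial_sum n i x : (i < n)%N -> N i x -> partial_sum n x.
Proof.
move=> + Nx; elim: n => // n IH; rewrite ltnS leq_eqVlt => /predU1P[<-|/IH xn].
  rewrite -[x]add0r; apply: partial_sumS => //.
  exact: submodule0 (submodule_partial_sum _).
by rewrite -[x]addr0; apply: partial_sumS => //; apply: submodule0.
Qed.

Lemma independent_partial_sum n x : independent N -> N n x -> partial_sum n x -> x = 0.
Proof.
move=> indep Nx xn; have Nx' : N n (- x) by apply: submoduleN.
move: xn => [z Nz zE].
pose w i := if i == n then - x else z i.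
have Nw i : N i (w i) by rewrite /w; case: eqP => [->|_].
have /(indep _ _ Nw)/(_ n (leqnn _)) : \sum_(i < n.+1) w i = 0.
  rewrite big_ord_recr /= {2}/w eqxx; apply/eqP; rewrite subr_eq0 {1}zE; apply/eqP.
  by apply: eq_bigr => i _; rewrite /w ltn_eqF.
by rewrite /w eqxx => /eqP; rewrite oppr_eq0 => /eqP.
Qed.

End PartialSums.

Lemma semisimple_complement (A : pzRingType) (M : lmodType A) (N : set M) :
  semisimple_module M -> submodule N ->
  exists D, [/\ submodule D, (forall x, N x -> D x -> x = 0) &
    forall z, submod_add N D z].
Proof.
move=> ssM sN; have [D [sD ND ess]] := exists_complement sN.
exists D; split=> // z; apply: (socle_sub_essential ess).
by rewrite [X in X z]ssM.
Qed.

(** * Linear maps and injective modules *)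

Lemma linear_of (A : pzRingType) (M M' : lmodType A) (f : M -> M') :
  (forall a x y, f (a *: x + y) = a *: f x + f y) ->
  exists g : {linear M -> M'}, forall x, g x = f x.
Proof.
move=> lf; pose L := GRing.isLinear.Build A M M' *:%R f lf.
pose g : {linear M -> M'} := HB.pack f L.
by exists g.
Qed.

Section LinearMaps.
Variables (A : pzRingType) (M M' : lmodType A).

Lemma submodule_range (f : {linear M -> M'}) : submodule (range f).
Proof.
apply: submoduleP; first by exists 0; rewrite ?linear0.
  by move=> _ _ [x _ <-] [y _ <-]; exists (x + y); rewrite ?linearD.
by move=> a _ [x _ <-]; exists (a *: x); rewrite ?linearZ.
Qed.

Lemma submodule_preimage (f : {linear M -> M'}) (N : set M') :
  submodule N -> submodule [set x | N (f x)].
Proof.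
move=> sN; apply: submoduleP => [|x y /= Nx Ny|a x /= Nx].
- by rewrite /= linear0; apply: submodule0.
- by rewrite linearD; apply: submoduleD.
- by rewrite linearZ; apply: submoduleZ.
Qed.

(** This provides the maps from simple left modules to R, which need not be
   injective as a left module over itself. *)
Lemma cyclic_map (x : M) (w : M') : (forall y, exists a : A, y = a *: x) ->
  (forall a : A, a *: x = 0 -> a *: w = 0) ->
  exists g : {linear M -> M'}, forall a : A, g (a *: x) = a *: w.
Proof.
move=> cx ann; have [c cE] := choice cx.
have well a b : a *: x = b *: x -> a *: w = b *: w.
  move=> ab; apply/eqP; rewrite -subr_eq0 -scalerBl; apply/eqP/ann.
  by rewrite scalerBl ab subrr.
have [|g gE] := @linear_of A M M' (fun y => c y *: w).
  move=> a y z; rewrite scalerA -scalerDl; apply: well.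
  by rewrite scalerDl -scalerA -!cE.
by exists g => a; rewrite gE; apply: well; rewrite -cE.
Qed.

(** Encoding a partial map by its graph avoids turning its domain into a module
   each time a map has to be extended. *)
Lemma injective_graph (G : set (M * M')%type) : injective_module M' ->
  submodule (G : set (M * M' : lmodType A)) -> (forall q, G (0, q) -> q = 0) ->
  exists g : {linear M -> M'}, forall m q, G (m, q) -> g m = q.
Proof.
move=> injQ sG G0.
have [i iE] : exists i : {linear submod_of sG -> M}, forall u, i u = (val u).1.
  by apply: linear_of => a x y; rewrite linearP.
have [f fE] : exists f : {linear submod_of sG -> M'}, forall u, f u = (val u).2.
  by apply: linear_of => a x y; rewrite linearP.
have Gval (u : submod_of sG) : G (val u) by case: u => u /= /set_mem.
have [|g gE] := injQ _ _ i f.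
  move=> u v; rewrite !iE => uv; apply/val_inj/eqP; rewrite -subr_eq0; apply/eqP.
  have := Gval (u - v); rewrite linearB /= => Guv.
  have e1 : (val u - val v).1 = 0 by rewrite /= uv subrr.
  move: Guv e1; case: (val u - val v) => m q /= Gmq m0.
  by rewrite m0 in Gmq *; rewrite (G0 _ Gmq).
exists g => m q Gmq; have Gmq' : (m, q) \in submod_pred sG by exact: mem_set.
by have := gE (Submod Gmq'); rewrite iE fE.
Qed.

Lemma injective_cyclic (x : M) (w : M') : injective_module M' ->
  (forall a : A, a *: x = 0 -> a *: w = 0) -> exists g : {linear M -> M'}, g x = w.
Proof.
move=> injQ ann.
have [||g gE] := @injective_graph [set p | exists a : A, p = (a *: x, a *: w)] injQ.
- apply: submoduleP; first by exists 0; rewrite !scale0r.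
  + by move=> _ _ [a ->] [b ->]; exists (a + b); rewrite !scalerDl.
  + by move=> c _ [a ->]; exists (c * a); rewrite -!scalerA.
- by move=> q [a [/esym/ann-> ->]].
by exists g; apply: gE; exists 1; rewrite !scale1r.
Qed.

Lemma injective_glue (N K : set M) (h : {linear M -> M'}) : injective_module M' ->
  submodule N -> submodule K -> (forall x, N x -> K x -> h x = 0) ->
  exists g : {linear M -> M'}, (forall x, N x -> g x = 0) /\ (forall x, K x -> g x = h x).
Proof.
move=> injQ sN sK h0.
have [||g gE] := @injective_graph
    [set p | exists2 x, N x & exists2 y, K y & p = (x + y, h y)] injQ.
- apply: submoduleP.
  + by exists 0; [apply: submodule0|exists 0; [apply: submodule0|rewrite linear0 addr0]].
  + move=> _ _ [x Nx [y Ky ->]] [x' Nx' [y' Ky' ->]].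
    exists (x + x'); first exact: submoduleD.
    exists (y + y'); first exact: submoduleD.
    by rewrite linearD addrACA.
  + move=> a _ [x Nx [y Ky ->]]; exists (a *: x); first exact: submoduleZ.
    exists (a *: y); first exact: submoduleZ.
    by rewrite linearZ -scalerDr.
- move=> q [x Nx [y Ky [/esym/eqP]]]; rewrite addr_eq0 => /eqP xy ->.
  by apply: h0 => //; rewrite -[y]opprK -xy; apply: submoduleN.
exists g; split=> x Hx; apply: gE.
  by exists x => //; exists 0; [apply: submodule0|rewrite linear0 addr0].
by exists 0; [apply: submodule0|exists x => //; rewrite add0r].
Qed.

Lemma injective_iso (h : {linear M -> M'}) : injective h -> (forall y, exists x, y = h x) ->
  injective_module M' -> injective_module M.
Proof.
move=> hinj hsurj injQ P P' i f iinj.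
have [k kE] := choice hsurj.
have [h' h'E] : exists h' : {linear M' -> M}, forall y, h' y = k y.
  by apply: linear_of => a y z; apply: hinj; rewrite linearP -!kE.
have [g gE] := injQ _ _ i (h \o f : {linear P -> M'}) iinj.
exists (h' \o g : {linear P' -> M}) => x /=; rewrite gE h'E.
by apply: hinj; rewrite -kE.
Qed.

End LinearMaps.

(** Take F above K maximal among the submodules disjoint from N, and G above N
   maximal among those disjoint from F. The map that is 0 on G and the identity on F
   extends to E; its kernel is G by maximality of G, so that its range is an
   essential extension of F, hence disjoint from N, hence equal to F. *)
Lemma injective_separation (A : pzRingType) (E : lmodType A) (N K : set E) :
  injective_module E -> submodule N -> submodule K ->
  (forall x, N x -> K x -> x = 0) ->
  exists p : {linear E -> E}, [/\ (forall x, p (p x) = p x),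
    (forall x, N x -> p x = 0) & (forall x, K x -> p x = x)].
Proof.
move=> injE sN sK NK.
have [|F [sF KF FN Fmax]] := @exists_maximal_avoiding A E K [set x | N x /\ x <> 0] sK.
  by move=> x Kx [Nx]; apply; apply: NK.
have [|G [sG NG GF Gmax]] := @exists_maximal_avoiding A E N [set x | F x /\ x <> 0] sN.
  by move=> x Nx [Fx x0]; apply: (FN x Fx).
have [|p [pG pF]] := @injective_glue A E E G F idfun injE sG sF.
  by move=> x Gx Fx /=; apply: contrapT => x0; apply: (GF x Gx).
have kerG x : p x = 0 -> G x.
  suff <- : [set x | p x = 0] = G by [].
  apply: Gmax => // [|y /= py [Fy]]; last by rewrite pF in py.
  exact: (submodule_preimage p (submodule_zero E)).
have rangeF : range p = F.
  apply: Fmax; [exact: submodule_range|by move=> x Fx; exists x => //; apply: pF|].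
  move=> w [z _ pz] [Nw w0].
  pose L := submod_add G [set a *: z | a in [set: A]].
  suff : L = G.
    move=> LG; apply: w0; rewrite -pz; apply: pG; rewrite -LG.
    by apply: submod_addr => //; apply: mem_cyclic.
  apply: Gmax; [exact: submodule_add (submodule_cyclic z)| |].
    exact: submod_addl (submodule_cyclic z).
  move=> _ [g Gg [_ [a _ <-] ->]] [Fx]; apply.
  have pE : p (g + a *: z) = a *: w by rewrite linearD linearZ pG // pz add0r.
  rewrite pF //= in pE; rewrite pE in Fx *; apply: contrapT => aw0.
  by apply: (FN (a *: w)) => //; split=> //; apply: submoduleZ.
exists p; split=> [x|x Nx|x Kx]; [|exact/pG/NG|exact/pF/KF].
by apply: (pF (p x)); rewrite -rangeF; exists x.
Qed.

(** * Right ideals and the Jacobson radical *)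

Section RightIdeals.
Variable R : pzRingType.
Implicit Types (I K L M : set R) (x y z a b : R).

Lemma scale_rightA (N : lmodType R^c) (a b : R) (x : N) :
  (a : R^c) *: ((b : R^c) *: x) = ((b * a : R) : R^c) *: x.
Proof. exact: scalerA. Qed.

Lemma right_scale1 a : (a : R^c) *: (1 : R%:right_mod) = a.
Proof. exact: (mul1r a). Qed.

Lemma right_idealP I : I 0 -> (forall x y, I x -> I y -> I (x + y)) ->
  (forall x a, I x -> I (x * a)) -> right_ideal I.
Proof. by move=> I0 ID IM; apply: submoduleP => // a x; apply: IM. Qed.

Lemma left_idealP I : I 0 -> (forall x y, I x -> I y -> I (x + y)) ->
  (forall a x, I x -> I (a * x)) -> left_ideal I.
Proof. by move=> I0 ID IM; apply: submoduleP. Qed.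

Lemma right_ideal0 I : right_ideal I -> I 0.
Proof. exact: submodule0. Qed.

Lemma right_idealD I x y : right_ideal I -> I x -> I y -> I (x + y).
Proof. exact: submoduleD. Qed.

Lemma right_idealB I x y : right_ideal I -> I x -> I y -> I (x - y).
Proof. exact: submoduleB. Qed.

Lemma right_idealM I x a : right_ideal I -> I x -> I (x * a).
Proof. by move=> rI Ix; apply: (submoduleZ (M := R%:right_mod) a rI Ix). Qed.

Lemma left_ideal0 I : left_ideal I -> I 0.
Proof. exact: submodule0. Qed.

Lemma left_idealD I x y : left_ideal I -> I x -> I y -> I (x + y).
Proof. exact: submoduleD. Qed.

Lemma left_idealM I a x : left_ideal I -> I x -> I (a * x).
Proof. by move=> rI Ix; apply: (submoduleZ (M := R%:left_mod) a rI Ix). Qed.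

Lemma right_ideal_preimage I a : right_ideal I -> right_ideal [set x | I (a * x)].
Proof.
move=> rI; apply: right_idealP => [|x y /= Ix Iy|x b /= Ix].
- by rewrite /= mulr0; apply: right_ideal0.
- by rewrite mulrDr; apply: right_idealD.
- by rewrite mulrA; apply: right_idealM.
Qed.

Lemma right_ideal_ann a : right_ideal [set x | a * x = 0].
Proof. exact: right_ideal_preimage (submodule_zero R%:right_mod). Qed.

Definition ideal_add I K : set R :=
  [set z | exists2 x, I x & exists2 y, K y & z = x + y].

Lemma right_ideal_complement I : right_ideal I ->
  exists C, [/\ right_ideal C, (forall x, I x -> C x -> x = 0) &
    essential_right_ideal (ideal_add I C)].
Proof. exact: (@exists_complement _ R%:right_mod). Qed.

Lemma essential_right_idealP I : right_ideal I ->
  essential_right_ideal I <-> (forall x, x <> 0 -> exists2 a, I (x * a) & x * a <> 0).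
Proof.
move=> rI; have essP := essentialP rI (submodule_setT R%:right_mod) (@subsetT _ _).
split=> [/essP h x|h]; first exact: h.
by apply/essP => x _; apply: h.
Qed.

Lemma essential_left_idealP I : left_ideal I ->
  essential_left_ideal I <-> (forall x, x <> 0 -> exists2 a, I (a * x) & a * x <> 0).
Proof.
move=> lI; have essP := essentialP lI (submodule_setT R%:left_mod) (@subsetT _ _).
split=> [/essP h x|h]; first exact: h.
by apply/essP => x _; apply: h.
Qed.

Lemma ideal_one I : right_ideal I -> I 1 -> I = setT.
Proof.
by move=> rI I1; apply/seteqP; split=> // x _; rewrite -[x]mul1r; apply: right_idealM.
Qed.

Lemma maximal_right_idealP M : right_ideal M -> ~ M 1 ->
  (forall L, right_ideal L -> M `<=` L -> ~ L 1 -> L = M) -> maximal_right_ideal M.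
Proof.
move=> rM M1 Mmax; split=> // [MT|L rL ML]; first by apply: M1; rewrite MT.
by have [/ideal_one-> //|/(Mmax L rL ML)] := pselect (L 1); [right|left].
Qed.

Lemma maximal_right M : maximal_right_ideal M -> right_ideal M.
Proof. by case. Qed.

Lemma maximal_not1 M : maximal_right_ideal M -> ~ M 1.
Proof. by move=> [rM MT _] M1; apply: MT; apply: ideal_one. Qed.

Lemma maximal_split M x : maximal_right_ideal M -> ~ M x ->
  exists2 m, M m & exists a, 1 = m + x * a.
Proof.
move=> maxM Mx; have [rM _ Mmax] := maxM.
pose L : set R := [set y | exists2 m, M m & exists a, y = m + x * a].
have rL : right_ideal L.
  apply: right_idealP; first by exists 0; [apply: right_ideal0|exists 0; rewrite mulr0 addr0].
    move=> _ _ [m Mm [a ->]] [n Mn [b ->]]; exists (m + n); first exact: right_idealD.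
    by exists (a + b); rewrite mulrDr addrACA.
  move=> _ b [m Mm [a ->]]; exists (m * b); first exact: right_idealM.
  by exists (a * b); rewrite mulrDl mulrA.
have ML : M `<=` L by move=> m Mm; exists m => //; exists 0; rewrite mulr0 addr0.
have [LM|LT] := Mmax L rL ML.
  case: Mx; rewrite -LM; exists 0; first exact: right_ideal0.
  by exists 1; rewrite mulr1 add0r.
by have : L 1 by rewrite LT.
Qed.

Lemma sub_maximal_right I : right_ideal I -> ~ I 1 ->
  exists2 M, maximal_right_ideal M & I `<=` M.
Proof.
move=> rI I1.
have [|M [sM IM M1 Mmax]] := @exists_maximal_avoiding _ R%:right_mod I ([set 1] : set R) rI.
  by move=> x Ix; rewrite /= => x1; apply: I1; rewrite -[1](x1 : x = 1 :> R).
exists M => //; apply: maximal_right_idealP => // [/M1|]; first exact.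
move=> L sL ML L1; apply: Mmax => // x Lx; rewrite /= => x1.
by apply: L1; rewrite -[1](x1 : x = 1 :> R).
Qed.

Lemma jacobson_sub_maximal M : maximal_right_ideal M -> jacobson R `<=` M.
Proof. by move=> maxM x; apply. Qed.

Lemma jacobson_right_inverse j : jacobson R j -> exists a, (1 - j) * a = 1.
Proof.
move=> Jj; apply: contrapT => noinv.
have [||M maxM IM] := @sub_maximal_right [set (1 - j) * a | a in [set: R]].
- exact: (submodule_cyclic (1 - j : R%:right_mod)).
- by move=> [a _ a1]; apply: noinv; exists a.
apply: (maximal_not1 maxM); rewrite -(subrK j 1).
apply: right_idealD (maximal_right maxM) _ (jacobson_sub_maximal maxM Jj).
by apply: IM; exists 1; rewrite ?mulr1.
Qed.

Lemma jacobson_left_inverse j : jacobson R j -> exists a, a * (1 - j) = 1.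
Proof.
move=> Jj; have [a a1] := jacobson_right_inverse Jj; exists a.
(* The right inverse a is of the form 1 - j' as well, hence has a right inverse. *)
have aE : a = 1 + j * a by rewrite -[1]a1 mulrBl mul1r subrK.
have [|b b1] := @jacobson_right_inverse (- (j * a)).
  rewrite -mulrN; exact: right_idealM (right_ideal_jacobson R) Jj.
suff <- : b = 1 - j by rewrite aE -[j * a]opprK b1.
by rewrite -[b]mul1r -[1 in LHS]a1 -mulrA {1}aE -[j * a]opprK b1 mulr1.
Qed.

Lemma jacobson_sufficient x :
  (forall a, exists b, (1 - x * a) * b = 1) -> jacobson R x.
Proof.
move=> inv M maxM; apply: contrapT => Mx.
have [m Mm [a e1]] := maximal_split maxM Mx.
have [b b1] := inv a; apply: (maximal_not1 maxM); rewrite -b1 e1 addrK.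
exact: right_idealM (maximal_right maxM) Mm.
Qed.

(** Nakayama's lemma. *)
Lemma nakayama_right (N : lmodType R^c) (K : set N) (x : N) (j : R) :
  submodule K -> jacobson R j -> K (x - (j : R^c) *: x) -> K x.
Proof.
move=> sK Jj Kx; have [a a1] := jacobson_right_inverse Jj.
suff -> : x = (a : R^c) *: (x - (j : R^c) *: x) by apply: submoduleZ.
have {1}-> : x = (((1 - j) * a : R) : R^c) *: x by rewrite a1 scale1r.
by rewrite -scale_rightA scalerBl scale1r.
Qed.

Lemma nakayama_left (x j : R) : jacobson R j -> x = j * x -> x = 0.
Proof.
move=> Jj xE; have [a a1] := jacobson_left_inverse Jj.
by rewrite -[x]mul1r -a1 -mulrA mulrBl mul1r -xE subrr mulr0.
Qed.

Lemma jacobson_mull a j : jacobson R j -> jacobson R (a * j).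
Proof. exact: left_idealM (left_ideal_jacobson R). Qed.

End RightIdeals.

(** * Semilocal rings *)

Section Semilocal.
Variable R : pzRingType.
Hypothesis R_semilocal : semilocal R.

Local Notation J := (jacobson R).
Local Notation HJ := (two_sided_ideal_jacobson R).
Local Notation Q := (quot_ring HJ).
Local Notation piQ := (\pi_(Quotient.quot (submod_pred HJ.2))).

(** Right ideals of R that contain J correspond to those of R/J. *)
Let down (K : set R) : set Q := [set u | K (repr u : R)].

Let downE (K : set R) (x : R) : right_ideal K -> J `<=` K ->
  down K (piQ x) <-> K x.
Proof.
move=> rK JK; have Kd : K ((repr (piQ x) : R) - x).
  apply: JK; have : repr (piQ x) - x \in submod_pred HJ.2.
    by rewrite Quotient.idealrBE reprK.
  by rewrite !inE.
split=> [Kp|Kx].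
  by rewrite -[x](subKr (repr (piQ x) : R)); apply: right_idealB.
by rewrite /down /= -(subrK x (repr _ : R)); apply: right_idealD.
Qed.

Let down_submodule (K : set R) : right_ideal K -> J `<=` K ->
  submodule (down K : set Q%:right_mod).
Proof.
move=> rK JK; apply: submoduleP.
- have -> : (0 : Q) = piQ 0 by exact: (esym (raddf0 piQ)).
  exact/(downE _ rK JK)/(right_ideal0 rK).
- elim/quotW=> x; elim/quotW=> y /(downE _ rK JK) Kx /(downE _ rK JK) Ky.
  rewrite [_ + _](pi_quot_ring_add HJ); exact/(downE _ rK JK)/(right_idealD rK Kx Ky).
- move=> a; elim/quotW: a => a; elim/quotW=> x /(downE _ rK JK) Kx.
  rewrite [_ *: _](pi_quot_mul HJ); apply/(downE _ rK JK); exact: (right_idealM (a : R) rK Kx).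
Qed.

Lemma semilocal_complement (K : set R) : right_ideal K -> J `<=` K ->
  exists D, [/\ right_ideal D, J `<=` D, (forall x, K x -> D x -> J x) &
    exists2 k, K k & exists2 d, D d & 1 = k + d].
Proof.
move=> rK JK.
have [D [sD KD KDT]] := semisimple_complement R_semilocal.1 (down_submodule rK JK).
have piQJ x : J x -> piQ x = (0 : Q).
  move=> Jx; rewrite -(raddf0 piQ); apply/eqP.
  by rewrite -Quotient.idealrBE subr0; apply/mem_set.
have piQ0 x : piQ x = (0 : Q) -> J x.
  rewrite -(raddf0 piQ) => /eqP; rewrite -Quotient.idealrBE subr0.
  exact: set_mem.
exists [set x | D (piQ x)]; split.
- apply: right_idealP => /= [|x y Dx Dy|x a Dx].
  + by rewrite raddf0; apply: (submodule0 sD).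
  + by rewrite -(pi_quot_ring_add HJ); apply: (submoduleD sD).
  + by rewrite -(pi_quot_mul HJ); exact: (submoduleZ (M := Q%:right_mod) (piQ a) sD Dx).
- by move=> x Jx /=; rewrite piQJ //; apply: (submodule0 sD).
- by move=> x Kx Dx; apply: piQ0; apply: KD => //; apply/(downE _ rK JK).
have [u Ku [v Dv e1]] := KDT (piQ 1).
elim/quotW: u => k in Ku e1; elim/quotW: v => d in Dv e1.
move: Ku => /(downE _ rK JK) Kk.
exists (1 - d); last by exists d; rewrite ?subrK.
rewrite -(subrK k (1 - d)); apply: (right_idealD rK _ Kk); apply: JK; apply: piQ0.
rewrite -addrA -opprD raddfB; apply/eqP; rewrite subr_eq0; apply/eqP.
by apply: (etrans e1); rewrite addrC; apply: (pi_quot_ring_add HJ d k).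
Qed.

Lemma semilocal_dcc (K : nat -> set R) : (forall n, right_ideal (K n)) ->
  (forall n, J `<=` K n) -> (forall n, K n.+1 `<=` K n) ->
  exists n, forall m, (n <= m)%N -> K m = K n.
Proof.
move=> rK JK Kdecr.
have [n|i|n nE] := R_semilocal.2 (fun n => down (K n)).
- exact: down_submodule.
- by move=> u; apply: Kdecr.
exists n => m /nE Kmn; apply/seteqP; split=> x Kx.
  by apply/(downE x (rK n) (JK n)); rewrite -Kmn; apply/(downE x (rK m) (JK m)).
by apply/(downE x (rK m) (JK m)); rewrite Kmn; apply/(downE x (rK n) (JK n)).
Qed.

Lemma semilocal_minimal (F : set (set R)) : (exists K, F K) ->
  (forall K, F K -> right_ideal K /\ J `<=` K) ->
  exists2 K, F K & forall L, F L -> L `<=` K -> L = K.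
Proof.
move=> [K0 FK0] FP; apply: contrapT => nomin.
have step (K : {K | F K}) : {L : {K | F K} | sval L `<` sval K}.
  apply: cid; case: K => K FK /=; apply: contrapT => noL.
  apply: nomin; exists K => // L FL LK; apply/seteqP; split=> //.
  by apply: contrapT => KL; apply: noL; exists (exist _ L FL).
have [K [_ Kdecr]] := dependent_choice step (exist _ K0 FK0).
have [n|n|n|n nE] := @semilocal_dcc (fun n => sval (K n)).
- exact: (FP _ (svalP (K n))).1.
- exact: (FP _ (svalP (K n))).2.
- exact: (Kdecr n).1.
by have [_] := Kdecr n; rewrite (nE n.+1 (leqnSn n)); apply.
Qed.

(** The ascending chain condition holds as well: the union of a chain is a
   summand modulo J, hence generated over J by one element of the chain. *)
Lemma semilocal_acc (K : nat -> set R) : (forall n, right_ideal (K n)) ->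
  J `<=` K 0 -> (forall n, K n `<=` K n.+1) -> exists n, K n.+1 `<=` K n.
Proof.
move=> rK JK0 Kincr.
have Kmono m n : (m <= n)%N -> K m `<=` K n.
  elim: n => [|n IH]; first by rewrite leqn0 => /eqP->.
  by rewrite leq_eqVlt => /predU1P[->//|/IH Kmn]; apply: subset_trans (Kincr n).
pose U := [set x | exists n, K n x].
have rU : right_ideal U.
  apply: right_idealP; first by exists 0; apply: right_ideal0.
    move=> x y [m Kx] [n Ky]; exists (maxn m n); apply: right_idealD => //.
      exact: Kmono (leq_maxl m n) _ Kx.
    exact: Kmono (leq_maxr m n) _ Ky.
  by move=> x a [n Kx]; exists n; apply: right_idealM.
have [|D [rD JD UD [k [n Kk] [d Dd e1]]]] := semilocal_complement rU.
  by move=> x Jx; exists 0; apply: JK0.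
exists n => z Kz.
have zE : z = k * z + d * z by rewrite -mulrDl -e1 mul1r.
rewrite zE; apply: right_idealD => //; first exact: right_idealM.
apply: (Kmono 0) => //; apply: JK0; apply: UD; last exact: right_idealM.
rewrite -[d * z](addKr (k * z)) -zE addrC; exists n.+1.
apply: right_idealB => //; apply: right_idealM => //; exact: Kincr.
Qed.

(** If D is a complement of M modulo J and d the component of 1 in D, then left
   multiplication by d embeds the simple module R/M into R/J. *)
Lemma semilocal_maximal (M : set R) : maximal_right_ideal M ->
  exists d, forall r, J (d * r) <-> M r.
Proof.
move=> maxM; have rM := maximal_right maxM.
have [D [rD JD MD [m Mm [d Dd e1]]]] := semilocal_complement rM (jacobson_sub_maximal maxM).
have rE r : r = m * r + d * r by rewrite -mulrDl -e1 mul1r.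
exists d => r; split=> [Jdr|Mr].
  rewrite (rE r); apply: right_idealD (jacobson_sub_maximal maxM Jdr) => //.
  exact: right_idealM.
apply: MD; last exact: right_idealM.
rewrite -[d * r](addKr (m * r)) -rE addrC; apply: right_idealB => //.
exact: right_idealM.
Qed.

End Semilocal.

(** * Cyclic injective modules over a semilocal ring *)

Section CyclicInjective.
Variable R : pzRingType.

Local Notation J := (jacobson R).

Lemma right_linear_mul (g : {linear R%:right_mod -> R%:right_mod}) (r : R) :
  g r = (g 1 : R) * r.
Proof. by rewrite -[in LHS](right_scale1 r) linearZZ. Qed.

Lemma iter_linear (A : pzRingType) (M : lmodType A) (f : {linear M -> M}) n :
  exists g : {linear M -> M}, forall x, g x = iter n f x.
Proof.
by apply: linear_of => a x y; elim: n => //= n ->; rewrite linearP.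
Qed.

(** Modulo xJ the images of the powers of phi become stationary, because R/J is
   Artinian. Applying the corresponding power of psi to the equality of two
   consecutive images gives E = phi(E) + xJ, and Nakayama's lemma concludes. *)
Lemma cyclic_dedekind_finite (E : lmodType R^c) (x : E) (phi psi : {linear E -> E}) :
  semilocal R -> (forall y, exists a : R, y = (a : R^c) *: x) ->
  (forall y, psi (phi y) = y) -> forall y, exists z, y = phi z.
Proof.
move=> slR cx psiK.
pose K n : set R := [set r | exists z, exists2 j, J j &
  (r : R^c) *: x = iter n phi z + (j : R^c) *: x].
have iterL n a y z : iter n phi (a *: y + z) = a *: iter n phi y + iter n phi z.
  by have [g gE] := iter_linear phi n; rewrite -!gE linearP.
have iter0 n : iter n phi 0 = 0.
  by have [g gE] := iter_linear phi n; rewrite -!gE linear0.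
have rK n : right_ideal (K n).
  apply: right_idealP.
  - exists 0, 0; first exact: right_ideal0 (right_ideal_jacobson R).
    by rewrite scale0r iter0 addr0.
  - move=> r s [z [j Jj rE]] [w [k Jk sE]].
    exists (z + w), (j + k); first exact: right_idealD (right_ideal_jacobson R) _ _.
    by rewrite -[z]scale1r iterL !scalerDl rE sE scale1r addrACA.
  - move=> r a [z [j Jj rE]]; exists ((a : R^c) *: z), (j * a).
      exact: right_idealM (right_ideal_jacobson R) _.
    rewrite -scale_rightA rE -[_ *: z]addr0 iterL iter0 addr0.
    by rewrite scalerDr scale_rightA.
have JK n : J `<=` K n by move=> j Jj; exists 0, j => //; rewrite iter0 add0r.
have Kdecr n : K n.+1 `<=` K n.
  by move=> r [z [j Jj rE]]; exists (phi z), j => //; rewrite rE iterSr.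
have [n nE] := semilocal_dcc slR rK JK Kdecr.
have [c cE] := cx (iter n phi x).
have [z [j Jj xE]] : K n.+1 c.
  rewrite nE //; exists x, 0; first exact: right_ideal0 (right_ideal_jacobson R).
  by rewrite scale0r addr0.
rewrite -cE in xE.
have iterK y : iter n psi (iter n phi y) = y.
  by elim: n y {cE xE nE} => // n IH y; rewrite [LHS]iterSr iterS psiK IH.
have [g gE] := iter_linear psi n; have [b bE] := cx (g x).
have phix : range phi x.
  apply: (@nakayama_right R E (range phi) x (b * j)) => //.
  - exact: submodule_range.
  - exact: jacobson_mull.
  exists z => //; apply/eqP; rewrite eq_sym subr_eq; apply/eqP.
  rewrite -scale_rightA -bE -linearZZ -[phi z]iterK -iterSr -gE -linearD -xE.
  by rewrite gE iterK.
move=> y; have [a ->] := cx y; have [w _ <-] := phix.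
by exists ((a : R^c) *: w); rewrite linearZZ.
Qed.

(** Let E(R) = xR and 1 = xa. Left multiplication by a extends to a split
   monomorphism of E(R), which is onto by Dedekind finiteness; so its image aR of R
   is essential. The annihilator of x meets aR trivially, hence vanishes, and
   R is isomorphic to E(R). *)
Theorem self_injective_of_cyclic_hull : semilocal R ->
  cyclic_injective_hull R%:right_mod -> injective_module R%:right_mod.
Proof.
move=> slR [E [i [[injE inji essi] [x cx]]]].
have iE (r : R) : i r = (r : R^c) *: i 1.
  by rewrite -linearZZ right_scale1.
have {}cx y : exists a : R, y = (a : R^c) *: x by have [a ->] := cx y; exists a.
have [a aE] := cx (i 1).
have iaE (r : R) : i ((a : R) * r) = (r : R^c) *: ((a : R^c) *: i 1).
  by rewrite iE -scale_rightA.
have kerE (r : R) : (r : R^c) *: i 1 = 0 -> r = 0.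
  by rewrite -iE -(linear0 i) => /inji.
have [|phi phi1] := @injective_cyclic _ E E (i 1) ((a : R^c) *: i 1) injE.
  by move=> r /kerE->; rewrite scale0r.
have phii (r : R) : phi (i r) = i ((a : R) * r) by rewrite iE linearZZ phi1 iaE.
have inj_a (r : R) : (a : R) * r = 0 -> r = 0.
  move=> ar0; apply: kerE; rewrite aE scale_rightA.
  by rewrite [_ * _]ar0 scale0r.
have ess y : y <> 0 -> exists r : R, exists2 s : R, (r : R^c) *: y = i s & s <> 0.
  have [/(_ essi)/(_ y I) hy _] :=
    essentialP (submodule_range i) (submodule_setT E) (@subsetT _ _).
  move=> /hy[r [s _ sE] ry]; exists r, s => // s0.
  by apply: ry; rewrite -sE s0 linear0.
have inj_phi y : phi y = 0 -> y = 0.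
  move=> phiy; apply: contrapT => /ess[r [s rs s0]]; apply: s0; apply: inj_a.
  by apply: inji; rewrite -phii -rs linearZZ phiy scaler0 linear0.
have [|psi psiK] := injE _ _ phi idfun.
  by move=> y z yz; apply/eqP; rewrite -subr_eq0; apply/eqP/inj_phi; rewrite linearB yz subrr.
have phi_onto := cyclic_dedekind_finite slR cx psiK.
have ann0 (t : R) : (t : R^c) *: x = 0 -> t = 0.
  move=> tx; apply: contrapT => t0; have [z zE] := phi_onto (i t).
  have [z0|/ess[r [s rs s0]]] := pselect (z = 0).
    by apply: t0; apply: inji; rewrite zE z0 !linear0.
  have trE : t * r = (a : R) * s.
    by apply: inji; rewrite -[RHS]phii -rs [RHS]linearZZ -zE [LHS]iE [i t]iE scale_rightA.
  apply: s0; apply: kerE; rewrite aE scale_rightA.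
  apply: etrans (congr1 (fun u : R => (u : R^c) *: x) (esym trE)) _.
  by rewrite -scale_rightA tx scaler0.
have [h hE] : exists h : {linear R%:right_mod -> E}, forall r : R, h r = (r : R^c) *: x.
  apply: linear_of => c r s; rewrite -[c *: r]/((r : R) * (c : R)).
  by rewrite scalerDl scale_rightA.
apply: (injective_iso (h := h)) injE => [r s|y]; last first.
  by have [r ->] := cx y; exists r; rewrite hE.
rewrite !hE => rs; apply/eqP; rewrite -subr_eq0; apply/eqP/ann0.
by rewrite scalerBl rs subrr.
Qed.

(** Direct summands F of E are given by idempotent endomorphisms p. Such an F
   determines two right ideals above J: the r that i maps into F, and the r with
   yr in F + EJ. The separation property of injective modules turns every right
   ideal properly above the first one into the first ideal of a larger summand,
   and enlarging F strictly enlarges the second one by Nakayama. If some t outside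
   J killed y, the second ideal of F = 0 would lie properly above its first one, and
   both could be enlarged in turn for ever. *)
Lemma generator_ann_sub_jacobson (E : lmodType R^c) (y : E)
    (i : {linear R%:right_mod -> E}) :
  semilocal R -> injective_module E ->
  (forall z, exists a : R, z = (a : R^c) *: y) -> (forall r, i r = 0 <-> J r) ->
  forall t : R, (t : R^c) *: y = 0 -> J t.
Proof.
move=> slR injE cy iJ t ty; apply: contrapT => Jt.
pose K (p : {linear E -> E}) : set R := [set r | p (i r) = i r].
pose L (p : {linear E -> E}) : set R := [set r | exists2 z, p z = z & exists2 j, J j &
  (r : R^c) *: y = z + (j : R^c) *: y].
have rJ := right_ideal_jacobson R.
have rK p : right_ideal (K p).
  apply: right_idealP => [|r s|r a]; rewrite /K /=.
  - by rewrite !linear0.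
  - by rewrite !linearD => -> ->.
  - by rewrite -[r * a]/((a : R^c) *: (r : R%:right_mod)) !linearZZ => ->.
have rL p : right_ideal (L p).
  apply: right_idealP.
  - exists 0; first by rewrite linear0.
    by exists 0; [exact: right_ideal0 rJ|rewrite !scale0r addr0].
  - move=> r s [z pz [j Jj rE]] [w pw [k Jk sE]].
    exists (z + w); first by rewrite linearD pz pw.
    exists (j + k); first exact: right_idealD rJ Jj Jk.
    by rewrite !scalerDl rE sE addrACA.
  - move=> r a [z pz [j Jj rE]].
    exists ((a : R^c) *: z); first by rewrite linearZZ pz.
    exists (j * a); first exact: right_idealM rJ Jj.
    by rewrite -scale_rightA rE scalerDr scale_rightA.
have JK p : J `<=` K p by move=> j /iJ ij; rewrite /K /= ij linear0.
have JL p : J `<=` L p.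
  by move=> j Jj; exists 0; [rewrite linear0|exists j; rewrite ?add0r].
pose good (p : {linear E -> E}) := [/\ forall z, p (p z) = p z, K p `<=` L p & ~ L p `<=` K p].
have step p : good p -> exists p', good p' /\ K p' = L p.
  move=> [pp KL LK].
  have [D [rD JD LD [l0 Ll0 [d0 Dd0 e1]]]] := semilocal_complement slR (rL p) (JL p).
  pose F := [set z | p z = z].
  have sF : submodule F.
    apply: submoduleP => [|z w|a z]; rewrite /F /= ?linear0 ?linearD ?linearZZ //.
      by move=> -> ->.
    by move=> ->.
  have sub_im (I : set R) : right_ideal I -> submodule [set i r | r in I].
    move=> rI; apply: submoduleP.
    - by exists 0; rewrite ?linear0 //; exact: right_ideal0 rI.
    - move=> _ _ [r Ir <-] [s Is <-]; exists (r + s); rewrite ?linearD //.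
      exact: right_idealD rI Ir Is.
    - move=> a _ [r Ir <-]; exists ((a : R^c) *: (r : R%:right_mod)).
        exact: (right_idealM (a : R) rI Ir).
      by rewrite linearZZ.
  (* The summand of p' contains F and i(L p) and misses i(D): it cuts out L p. *)
  have [|p' [p'p' p'D p'F]] := @injective_separation _ E [set i d | d in D]
      (submod_add F [set i l | l in L p]) injE (sub_im D rD)
      (submodule_add sF (sub_im _ (rL p))).
    move=> _ [d Dd <-] [f Ff [_ [l Ll <-] idE]]; apply/iJ; apply: LD => //.
    rewrite -(subrK l d); apply: right_idealD => //; apply: KL.
    suff -> : K p (d - l) = F f by [].
    by rewrite /K /F /= linearB idE addrK.
  have {}p'D d : D d -> p' (i d) = 0 by move=> Dd; apply: p'D; exists d.
  have p'L l : L p l -> p' (i l) = i l.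
    by move=> Ll; apply/p'F/submod_addr => //; exists l.
  have {}p'F z : p z = z -> p' z = z.
    by move=> pz; apply/p'F; apply: submod_addl => //; apply: sub_im.
  have KL' : K p' = L p.
    apply/seteqP; split=> r; last exact: p'L.
    have rE : r = l0 * r + d0 * r by rewrite -mulrDl -e1 mul1r.
    have Llr : L p (l0 * r) := right_idealM r (rL p) Ll0.
    have Ddr : D (d0 * r) := right_idealM r rD Dd0.
    have irE : i r = i (l0 * r) + i (d0 * r) by rewrite -linearD -rE.
    rewrite /K /= irE linearD p'L // p'D // addr0 => iE.
    have /iJ Jdr : i (d0 * r) = 0 by apply: (addrI (i (l0 * r))); rewrite addr0 -iE.
    by rewrite rE; apply: (right_idealD (rL p) Llr (JL p _ Jdr)).
  exists p'; split=> //; split=> //; rewrite KL'.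
    by move=> r [z pz h]; exists z => //; apply: p'F.
  (* Were L p' inside L p, Nakayama's lemma would put p' y, and so p' E, into F. *)
  move=> LL'; have [r rE] := cy (p' y).
  have [|z pz [j Jj p'yE]] := LL' r.
    exists (p' y) => //; exists 0; first exact: right_ideal0 rJ.
    by rewrite scale0r addr0 rE.
  rewrite -rE in p'yE.
  have Fp'y : F (p' y).
    apply: (nakayama_right sF Jj); suff -> : p' y - (j : R^c) *: p' y = z by [].
    apply/eqP; rewrite subr_eq; apply/eqP.
    by rewrite -[LHS]p'p' {1}p'yE linearD linearZZ p'F.
  apply: LK; rewrite -KL' => s; rewrite /K /= => <-.
  by have [a ->] := cy (i s); rewrite !linearZZ Fp'y.
have [p0 p0E] : exists p : {linear E -> E}, forall z, p z = 0.
  by apply: linear_of => a z w; rewrite scaler0 addr0.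
have K0 : K p0 = J.
  by apply/seteqP; split=> r; rewrite /K /= p0E => h; [apply/iJ|apply/esym/iJ].
have good0 : good p0.
  split=> [z||LK]; [by rewrite !p0E|by rewrite K0; apply: JL|].
  apply: Jt; rewrite -K0; apply: LK; exists 0; first by rewrite linear0.
  by exists 0; [exact: right_ideal0 rJ|rewrite ty scale0r addr0].
have step' (p : {p | good p}) : {p' : {p | good p} | K (sval p') = L (sval p)}.
  apply: cid; have [p' [gp' p'E]] := step _ (svalP p).
  by exists (exist _ p' gp').
have [p [_ pE]] := dependent_choice step' (exist _ p0 good0).
have [n|||n] := @semilocal_acc R slR (fun n => K (sval (p n))).
- exact: rK.
- exact: JK.
- by move=> n; rewrite pE; have [] := svalP (p n).
by rewrite pE; have [] := svalP (p n).
Qed.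

(** The right ideal eR + vJ plus a complement is essential, hence two-sided, and
   contains re. Comparing components shows that v lies in the complement up to eR
   and an invertible factor, so that vJ vanishes. *)
Lemma duo_idempotent (e r j : R) : essentially_right_duo R -> e * e = e -> J j ->
  (1 - e) * r * e * j = 0.
Proof.
move=> duo ee Jj; set v := (1 - e) * r * e.
have ev x : e * (v * x) = 0 by rewrite /v !mulrA mulrBr mulr1 ee subrr !mul0r.
have rJ := right_ideal_jacobson R.
pose P : set R := [set x | exists a, exists2 k, J k & x = e * a + v * k].
have rP : right_ideal P.
  apply: right_idealP.
  - by exists 0, 0; [exact: right_ideal0 rJ|rewrite !mulr0 addr0].
  - move=> _ _ [a [k Jk ->]] [b [l Jl ->]]; exists (a + b), (k + l).
      exact: right_idealD rJ Jk Jl.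
    by rewrite !mulrDr addrACA.
  - move=> _ b [a [k Jk ->]]; exists (a * b), (k * b); first exact: right_idealM rJ Jk.
    by rewrite mulrDl !mulrA.
have [C [rC PC ess]] := right_ideal_complement rP.
have [lX _] := duo _ ess.
have [_ [a [k Jk ->]] [c Cc reE]] : ideal_add P C (r * e).
  apply: (left_idealM r lX); exists e.
    by exists 1, 0; [exact: right_ideal0 rJ|rewrite mulr1 mulr0 addr0].
  by exists 0; [exact: right_ideal0 rC|rewrite addr0].
have [u u1] := jacobson_right_inverse Jk.
(* As cu and v agree up to eR, the element cuj of C also lies in P, hence is zero. *)
have cE : c * u = v + e * ((r * e - a) * u).
  have -> : c = v * (1 - k) + e * (r * e - a).
    have -> : c = r * e - (e * a + v * k).
      by apply/eqP; rewrite eq_sym subr_eq addrC -reE.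
    have vE : v = r * e - e * (r * e) by rewrite /v -mulrA mulrBl mul1r.
    by rewrite mulrBr mulr1 mulrBr {2}vE addrACA subrK opprD [- _ - _]addrC.
  by rewrite mulrDl -[v * _ * u]mulrA u1 mulr1 mulrA.
have cuj0 : c * u * j = 0.
  apply: PC.
    rewrite cE mulrDl addrC; exists ((r * e - a) * u * j), j => //.
    by rewrite !mulrA.
  exact: right_idealM (right_idealM u rC Cc).
have vjE : v * j = - (e * ((r * e - a) * u * j)).
  by move: cuj0; rewrite cE mulrDl => /eqP; rewrite addr_eq0 => /eqP->; rewrite !mulrA.
have := ev j; rewrite vjE mulrN !mulrA ee => /eqP; rewrite oppr_eq0 => /eqP.
by rewrite -!mulrA mulrA => ->; rewrite oppr0.
Qed.

(** The hull of R/J is a quotient R/T of the self-injective ring R, with T inside J.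
   T is essential in a right ideal eR with e idempotent, so that T + (1-e)R is
   two-sided; since (1-e)ReJ = 0, so is T. But the hull of R/J is a faithful module,
   as every nonzero principal right ideal maps onto a simple module and thus maps
   nontrivially into R/J. Hence T = 0 and R itself is an injective hull of R/J. *)
Theorem jacobson_annihilator_essential : semilocal R -> essentially_right_duo R ->
  injective_module R%:right_mod -> cyclic_injective_hull (quot_jacobson_right_mod R) ->
  exists s0 : R, (forall r, s0 * r = 0 <-> J r) /\
    essential_right_ideal [set s0 * r | r in [set: R]].
Proof.
move=> slR duo injR [E [i' [[injE inji essi] [y cy]]]].
have {}cy z : exists a : R, z = (a : R^c) *: y by have [a ->] := cy z; exists a.
have [i iE] : exists i : {linear R%:right_mod -> E},
    forall r, i r = i' (\pi_(Quotient.quot (submod_pred (right_ideal_jacobson R))) r).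
  apply: linear_of => a r s; rewrite -linearP; congr (i' _).
  rewrite -[X in _ = X + _]/(quot_scale _ _) pi_quot_scale.
  exact/esym/pi_quot_add.
have iJ r : i r = 0 <-> J r.
  rewrite iE -(linear0 i'); split=> [/inji|Jr].
    rewrite -(raddf0 (\pi_(Quotient.quot (submod_pred (right_ideal_jacobson R))))) => /eqP.
    by rewrite -Quotient.idealrBE subr0 => /set_mem.
  congr (i' _); rewrite -(raddf0 (\pi_(Quotient.quot (submod_pred (right_ideal_jacobson R))))).
  by apply/eqP; rewrite -Quotient.idealrBE subr0; apply/mem_set.
have iM (r : R) : i r = (r : R^c) *: i 1.
  by rewrite -linearZZ right_scale1.
have TJ := generator_ann_sub_jacobson slR injE cy iJ.
pose T : set R := [set t | (t : R^c) *: y = 0].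
have rT : right_ideal T by exact: submodule_ann.
have [N [rN TN ess]] := right_ideal_complement rT.
have [|p [pp pN pT]] := injective_separation injR rN rT.
  by move=> x Nx Tx; apply: TN.
have [e peE] : exists e : R, forall r : R, p r = e * r.
  by exists (p 1) => r; exact: right_linear_mul.
have ee : e * e = e by have := pp 1; rewrite !peE mulr1.
pose X : set R := [set x | exists2 t, T t & exists a, x = t + (1 - e) * a].
have rX : right_ideal X.
  apply: right_idealP.
  - by exists 0; [exact: right_ideal0 rT|exists 0; rewrite mulr0 addr0].
  - move=> _ _ [t Tt [a ->]] [u Tu [b ->]]; exists (t + u); first exact: right_idealD rT Tt Tu.
    by exists (a + b); rewrite mulrDr addrACA.
  - move=> _ b [t Tt [a ->]]; exists (t * b); first exact: right_idealM rT Tt.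
    by exists (a * b); rewrite mulrDl mulrA.
have [lX _] : two_sided_ideal X.
  apply: duo; apply: (essential_sub rX ess) => // x [t Tt [n Nn ->]].
  exists t => //; exists n; have := pN n Nn; rewrite peE => en.
  by rewrite mulrBl mul1r en subr0.
have lT a t : T t -> T (a * t).
  move=> Tt; have et : e * t = t by rewrite -peE; apply: pT.
  have eat : e * (a * t) = a * t.
    have := duo_idempotent a duo ee (TJ t Tt).
    rewrite -!mulrA et mulrBl mul1r => /eqP; rewrite subr_eq0 => /eqP.
    by move=> {2}->.
  have [|t' Tt' [b bE]] := left_idealM a lX (_ : X t).
    by exists t => //; exists 0; rewrite mulr0 addr0.
  have et' : e * t' = t' by rewrite -peE; apply: pT.
  by rewrite -eat bE mulrDr et' mulrA mulrBr mulr1 ee subrr mul0r addr0.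
have T0 t : T t -> t = 0.
  move=> Tt; apply: contrapT => t0.
  have [|M maxM annM] := sub_maximal_right (right_ideal_ann t).
    by rewrite /= mulr1.
  have [d dM] := semilocal_maximal slR maxM.
  have [|h hE] := @injective_cyclic _ R%:right_mod E t (i d) injE.
    move=> a ta; rewrite -linearZZ; apply/iJ/dM/annM; exact: ta.
  have [c cE] := cy (h 1).
  have := lT c t Tt; rewrite /T /= -scale_rightA -cE -linearZZ.
  rewrite right_scale1 hE => /iJ Jd; apply: (maximal_not1 maxM); apply/dM.
  by rewrite mulr1.
have [s0 s0E] := cy (i 1).
have iy (r : R) : i r = ((s0 * r : R) : R^c) *: y by rewrite iM s0E scale_rightA.
exists s0; split=> [r|].
  by rewrite -iJ iy; split=> [->|/T0//]; rewrite scale0r.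
apply/essentialP => //; first exact: (submodule_cyclic (s0 : R%:right_mod)).
move=> x _ x0; have xy : (x : R^c) *: y <> 0 by move=> /T0.
have [/(_ essi)/(_ _ I xy)[a [u _ uE] auy] _] :=
  essentialP (submodule_range i') (submodule_setT E) (@subsetT _ _).
elim/quotW: u uE => r; rewrite -iE iy scale_rightA => rE.
have e0 : s0 * (r : R) = (x : R) * (a : R).
  apply/eqP; rewrite -subr_eq0; apply/eqP/T0.
  by rewrite /T /= scalerBl rE subrr.
exists a; first by exists r.
move=> xa0; apply: auy; rewrite scale_rightA.
exact: etrans (congr1 (fun u : R => (u : R^c) *: y) xa0) (scale0r y).
Qed.

End CyclicInjective.

(** * Local idempotents *)

(** The unique maximal right ideal is the Jacobson radical, hence a left ideal too;
   this makes right invertible elements invertible. *)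
Lemma local_ring_unit (A : pzRingType) (x : A) : local_ring A ->
  (exists y, x * y = 1 /\ y * x = 1) \/ (exists y, (1 - x) * y = 1 /\ y * (1 - x) = 1).
Proof.
move=> [M [maxM uniqM]]; have rM := maximal_right maxM.
have MJ : M = jacobson A.
  by apply/seteqP; split=> z Mz; [move=> N maxN; rewrite -(uniqM N maxN)|apply: Mz].
have rinv z : ~ M z -> exists y, z * y = 1.
  move=> Mz; apply: contrapT => noinv.
  have [||N maxN zN] := @sub_maximal_right A [set z * a | a in [set: A]].
  - exact: (submodule_cyclic (z : A%:right_mod)).
  - by move=> [y _ y1]; apply: noinv; exists y.
  apply: Mz; rewrite (uniqM N maxN); apply: zN; exists 1 => //; exact: mulr1.
have inv z : ~ M z -> exists y, z * y = 1 /\ y * z = 1.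
  move=> Mz; have [y y1] := rinv z Mz.
  have [|w w1] := rinv y.
    by rewrite MJ => Jy; apply: (maximal_not1 maxM); rewrite -y1 MJ; apply: jacobson_mull.
  have zw : z = w by rewrite -[z]mulr1 -w1 mulrA y1 mul1r.
  by exists y; split=> //; rewrite zw.
have [Mx|/inv] := pselect (M x); last by left.
right; apply: inv => M1x; apply: (maximal_not1 maxM).
by rewrite -(subrK x 1); apply: right_idealD.
Qed.

Lemma local_idempotent_unit (R : pzRingType) (e x : R) : local_idempotent e ->
  (exists y, (e * x * e) * y = e /\ y * (e * x * e) = e) \/
  (exists y, (e - e * x * e) * y = e /\ y * (e - e * x * e) = e).
Proof.
move=> [ee loc].
have exe : e * x * e \in corner_pred ee by rewrite inE !mulrA ee -!mulrA ee.
by have [[y [xy yx]]|[y [xy yx]]] := local_ring_unit (Corner exe) loc;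
  [left|right]; exists (val y); split;
  [have := congr1 val xy|have := congr1 val yx|have := congr1 val xy|have := congr1 val yx].
Qed.

Lemma local_idempotent_neq0 (R : pzRingType) (e : R) : local_idempotent e -> e <> 0.
Proof.
move=> [ee [M [maxM _]]] e0; apply: (maximal_not1 maxM).
suff -> : (1 : corner ee) = 0 by exact: right_ideal0 (maximal_right maxM).
by apply/val_inj; rewrite /= e0.
Qed.

(** If M and M' differ, 1 = n + ma with n in M' and m in M. Compressing to eRe, one of ene
   and e - ene = emae is invertible there, and then e is in M' or in M. *)
Lemma local_idempotent_maximal (R : pzRingType) (e : R) (M M' : set R) :
  local_idempotent e -> maximal_right_ideal M -> maximal_right_ideal M' ->
  M (1 - e) -> M' (1 - e) -> M = M'.
Proof.
move=> loc maxM maxM' Me Me'; have ee : e * e = e by case: loc.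
suff sub N N' : maximal_right_ideal N -> maximal_right_ideal N' ->
    N (1 - e) -> N' (1 - e) -> N `<=` N' by apply/seteqP; split; apply: sub.
move=> {M M' maxM maxM' Me Me'} maxN maxN' Ne Ne' m Nm; apply: contrapT => N'm.
have [rN rN'] := (maximal_right maxN, maximal_right maxN').
have emove K z : right_ideal K -> K (1 - e) -> K z -> K (e * z).
  move=> rK Ke Kz; rewrite (_ : e * z = z - (1 - e) * z).
    by apply: right_idealB => //; apply: right_idealM.
  by rewrite mulrBl mul1r subKr.
have not_e K : maximal_right_ideal K -> K (1 - e) -> ~ K e.
  move=> maxK Ke Kee; apply: (maximal_not1 maxK); rewrite -(subrK e 1).
  exact: right_idealD (maximal_right maxK) Ke Kee.
have [n N'n [a e1]] := maximal_split maxN' N'm.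
have eE : e - e * n * e = e * (m * a) * e.
  by apply/eqP; rewrite subr_eq -mulrDl -mulrDr [m * a + n]addrC -e1 mulr1 ee.
have [[y [ny _]]|[y [ny _]]] := local_idempotent_unit n loc.
  apply: (not_e N' maxN' Ne'); rewrite -ny -!mulrA; apply: emove => //.
  exact: right_idealM.
apply: (not_e N maxN Ne); rewrite -ny eE -!mulrA; apply: emove => //.
exact: right_idealM.
Qed.

(** * Self-injective rings that are an injective hull of R/J *)

Section SelfInjective.
Variable R : pzRingType.
Variable s0 : R.
Implicit Types (I K L M N : set R) (x y z a b c d r s w j e : R).

Local Notation J := (jacobson R).
Let S : set R := [set s0 * r | r in [set: R]].

Hypothesis slR : semilocal R.
Hypothesis injR : injective_module R%:right_mod.
Hypothesis s0J : forall r, s0 * r = 0 <-> J r.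
Hypothesis essS : essential_right_ideal S.
Hypothesis duo : essentially_right_duo R.

Let lS : left_ideal S := (duo essS).1.
Let rS : right_ideal S := submodule_cyclic (s0 : R%:right_mod).

Let essSE x : x <> 0 -> exists2 a, S (x * a) & x * a <> 0.
Proof. exact: (essential_right_idealP rS).1. Qed.

Lemma self_injective_left_multiple a b :
  (forall r, a * r = 0 -> b * r = 0) -> exists c, b = c * a.
Proof.
move=> ann.
have [|g gE] := @injective_cyclic _ R%:right_mod R%:right_mod a b injR; first exact: ann.
by exists (g 1); rewrite -right_linear_mul.
Qed.

(** By induction on F: if w kills the elements x of K with ax = 0, then the map that
   is 0 on the annihilator of a and left multiplication by w on K extends to left
   multiplication by some g; here g is in Ra and w - g kills K. *)
Lemma self_injective_annihilated (F : seq R) L w : left_ideal L ->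
  (forall l, l \in F -> L l) ->
  (forall r, (forall l, l \in F -> l * r = 0) -> w * r = 0) -> L w.
Proof.
move=> lL; elim: F w => [|a F IH] w FL ann.
  by rewrite -[w]mulr1 ann //; apply: left_ideal0.
pose K : set R := [set r | forall l, l \in F -> l * r = 0].
have rK : right_ideal K.
  apply: right_idealP => [l Fl|r s Kr Ks l Fl|r b Kr l Fl]; first by rewrite mulr0.
    by rewrite mulrDr Kr ?Ks ?addr0.
  by rewrite mulrA Kr ?mul0r.
have [wl wE] : exists g : {linear R%:right_mod -> R%:right_mod}, forall r : R, g r = w * r.
  apply: linear_of => c r s.
  exact: etrans (mulrDr _ _ _) (congr1 (fun z => z + w * s) (mulrA _ _ _)).
have [|g [g0 gK]] := injective_glue (h := wl) injR (right_ideal_ann a) rK.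
  move=> r ar Kr; rewrite wE; apply: ann => l; rewrite inE => /predU1P[->//|]; exact: Kr.
have [c cE] : exists c, (g 1 : R) = c * a.
  apply: self_injective_left_multiple => r ar; rewrite -right_linear_mul; exact: g0.
rewrite -[w](subrK (g 1 : R)); apply: left_idealD => //.
  apply: IH => [l Fl|r Kr]; first by apply: FL; rewrite inE Fl orbT.
  by rewrite mulrBl -wE -right_linear_mul gK // subrr.
by rewrite cE; apply: left_idealM => //; apply: FL; rewrite inE eqxx.
Qed.

(** A simple right module embeds in R/J, of which S is a copy. *)
Lemma maximal_right_annihilator M : maximal_right_ideal M ->
  exists2 s, S s & forall r, s * r = 0 <-> M r.
Proof.
move=> maxM; have [d dM] := semilocal_maximal slR maxM.
by exists (s0 * d) => [|r]; [exists d|rewrite -mulrA; apply: iff_trans (s0J _) (dM r)].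
Qed.

Lemma exists_maximal_left_multiple a : a <> 0 ->
  exists c, [/\ S (c * a), c * a <> 0 & maximal_right_ideal [set r | c * a * r = 0]].
Proof.
move=> a0; have [|M maxM annM] := sub_maximal_right (right_ideal_ann a).
  by rewrite /= mulr1.
have [s Ss sM] := maximal_right_annihilator maxM.
have [|c cE] := @self_injective_left_multiple a s; first by move=> r /annM/sM.
exists c; rewrite -cE; split=> // [s_eq0|].
  by apply: (maximal_not1 maxM); apply/sM; rewrite s_eq0 mul0r.
by suff -> : [set r | s * r = 0] = M by []; apply/seteqP; split=> r /sM.
Qed.

Lemma socle_mul_jacobson s j : S s -> J j -> s * j = 0.
Proof. by move=> [r _ <-] Jj; rewrite -mulrA; apply/s0J; exact: jacobson_mull. Qed.

(** Split 1 = k + d modulo J along the annihilator K of js. Then jsk = 0, while sd and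
   jsd have the same right annihilator, so that sd is a left multiple of jsd
   and vanishes by Nakayama's lemma. *)
Lemma jacobson_mul_socle j s : J j -> S s -> j * s = 0.
Proof.
move=> Jj Ss.
pose K : set R := [set r | j * s * r = 0].
have rK : right_ideal K := right_ideal_ann (j * s).
have [|D [rD JD KD [k Kk [d Dd e1]]]] := semilocal_complement slR rK.
  by move=> r Jr; rewrite /K /= -mulrA (socle_mul_jacobson Ss Jr) mulr0.
have sd0 : s * d = 0.
  have [|c cE] := @self_injective_left_multiple (j * (s * d)) (s * d).
    move=> r jsdr; have Jdr : J (d * r).
      by apply: KD; [rewrite /K /= -jsdr !mulrA|exact: right_idealM].
    by rewrite -mulrA (socle_mul_jacobson Ss Jdr).
  by apply: (@nakayama_left R (s * d) (c * j)); [exact: jacobson_mull|rewrite -mulrA].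
by rewrite -[j * s]mulr1 e1 mulrDr [_ * k]Kk add0r -mulrA sd0 mulr0.
Qed.

(** The part of R/J that s0 sends into I has a complement D, and no nonzero multiple of
   an element of s0 D lies in I. Hence s0 D = 0, and s0 is in I. *)
Lemma socle_sub_essential_right I : essential_right_ideal I -> S `<=` I.
Proof.
move=> essI; have rI : right_ideal I by case: essI.
have /(essential_right_idealP rI) h := essI.
have rK : right_ideal [set r | I (s0 * r)] := right_ideal_preimage s0 rI.
have [|D [rD JD KD [k Kk [d Dd e1]]]] := semilocal_complement slR rK.
  by move=> r /s0J Jr; rewrite /= Jr; apply: right_ideal0.
suff Is0 : I s0 by move=> _ [r _ <-]; apply: right_idealM.
rewrite -[s0]mulr1 e1 mulrDr; apply: right_idealD => //.
have [->|/h[a Ia a0]] := pselect (s0 * d = 0); first exact: right_ideal0.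
have : J (d * a) by apply: KD; [rewrite /= mulrA|exact: right_idealM].
by move=> /s0J; rewrite mulrA => /a0.
Qed.

(** * Simple one-sided ideals *)

(** A nonzero multiple of s has the same right annihilator as s, by maximality, and
   hence generates the same left ideal. *)
Lemma simple_left_principal s : maximal_right_ideal [set r | s * r = 0] ->
  simple_submodule ([set c * s | c in [set: R]] : set R%:left_mod).
Proof.
move=> maxs; have s_neq0 : s <> 0.
  by move=> s_eq0; apply: (maximal_not1 maxs); rewrite /= s_eq0 mul0r.
split; [exact: (submodule_cyclic (s : R%:left_mod))| |].
  by move=> eq0; have := mem_cyclic (s : R%:left_mod); rewrite [X in X _]eq0.
move=> L lL Ls; have [->|L0] := pselect (L = [set 0]); [by left|right].
have [x Lx x0] := nonzero_submodule lL L0; have [c _ cE] := Ls x Lx.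
have [|d dE] := @self_injective_left_multiple x s.
  have [rs _ smax] := maxs.
  have [|xs r xr|xT] := smax [set r | x * r = 0] (right_ideal_ann x).
  - by move=> r /= sr; rewrite -cE -mulrA sr mulr0.
  - by suff : [set r | s * r = 0] r by []; rewrite -xs.
  - by case: x0; rewrite -[x]mulr1; have : [set r | x * r = 0] 1 by rewrite xT.
apply/seteqP; split=> // _ [b _ <-].
by rewrite dE mulrA; apply: (left_idealM (b * d) lL Lx).
Qed.

Lemma simple_right_maximal N x : simple_submodule (N : set R%:right_mod) ->
  N x -> x <> 0 -> maximal_right_ideal [set r | x * r = 0].
Proof.
move=> [rN _ Nmin] Nx x0; apply: maximal_right_idealP; first exact: right_ideal_ann.
  by rewrite /= mulr1.
move=> K rK annK K1; apply/seteqP; split=> // k Kk; apply: contrapT => xk0.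
pose L : set R := [set x * r | r in K].
have rL : right_ideal L.
  apply: right_idealP; first by exists 0; [exact: right_ideal0|rewrite mulr0].
    move=> _ _ [r Kr <-] [s Ks <-]; exists (r + s); last by rewrite mulrDr.
    exact: right_idealD.
  by move=> _ a [r Kr <-]; exists (r * a); [exact: right_idealM|rewrite mulrA].
have [|L0|LN] := Nmin L rL.
- by move=> _ [r _ <-]; apply: (right_idealM r rN Nx).
- have : L (x * k) by exists k.
  by rewrite L0.
have [r Kr xr] : L x by rewrite LN.
apply: K1; rewrite -(subrK r 1); apply: right_idealD => //; apply: annK.
by rewrite /= mulrBr mulr1 xr subrr.
Qed.

(** Among the right ideals properly above J that s0 sends into xR pick a minimal one. *)
Lemma exists_simple_right x : x <> 0 -> exists N : set R%:right_mod,
  [/\ simple_submodule N, N `<=` right_principal x & exists2 a, N (x * a) & x * a <> 0].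
Proof.
move=> x0; have [a [r _ rE] xa0] := essSE x0.
pose F : set (set R) := [set K | [/\ right_ideal K, J `<=` K, ~ K `<=` J &
  forall k, K k -> right_principal x (s0 * k)]].
have rx : right_ideal (right_principal x) := submodule_cyclic (x : R%:right_mod).
have [||K [rK JK KJ Kx] Kmin] := @semilocal_minimal R slR F.
- exists [set k | right_principal x (s0 * k)]; split=> //.
  + exact: right_ideal_preimage.
  + by move=> j /s0J j0; rewrite /= j0; exact: right_ideal0.
  + by move=> /(_ r); rewrite /= rE => /(_ (imageT _ a))/s0J; rewrite rE.
- by move=> K [].
have /existsNP[k /not_implyP[Kk Jk]] := KJ.
pose N : set R := [set s0 * r | r in K].
have rN : right_ideal N.
  apply: right_idealP; first by exists 0; [exact: right_ideal0|rewrite mulr0].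
    move=> _ _ [u Ku <-] [v Kv <-]; exists (u + v); last by rewrite mulrDr.
    exact: right_idealD.
  by move=> _ b [u Ku <-]; exists (u * b); [exact: right_idealM|rewrite mulrA].
have Nx : N `<=` right_principal x by move=> _ [u Ku <-]; apply: Kx.
have Nk : N (s0 * k) by exists k.
have k0 : s0 * k <> 0 by move=> /s0J.
exists N; split=> //; last first.
  by have [b _ bE] := Nx _ Nk; exists b; rewrite bE.
split=> // [N0|L rL LN]; first by rewrite N0 in Nk.
have [LJ|LJ] := pselect ([set u | K u /\ L (s0 * u)] `<=` J).
  left; apply/seteqP; split=> [y Ly|_ ->]; last exact: submodule0.
  have [u Ku uE] := LN y Ly; rewrite -uE in Ly *.
  by apply/s0J; apply: LJ; exact: (conj Ku Ly).
right; apply/seteqP; split=> // _ [u Ku <-].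
suff KL : [set v | K v /\ L (s0 * v)] = K by move: Ku; rewrite -KL => -[].
apply: Kmin; last by move=> v [].
split=> //; last by move=> v [/Kx].
  apply: right_idealP => [|v w [Kv Lv] [Kw Lw]|v b [Kv Lv]].
  - by split; [exact: right_ideal0|rewrite mulr0; exact: right_ideal0 rL].
  - split; first exact: right_idealD.
    by rewrite mulrDr; exact: right_idealD rL Lv Lw.
  - split; first exact: right_idealM.
    by rewrite mulrA; exact: right_idealM rL Lv.
move=> j Jj; split; first exact: JK.
by have /s0J-> := Jj; exact: right_ideal0 rL.
Qed.

Lemma exists_simple_left a : a <> 0 -> exists N : set R%:left_mod,
  [/\ simple_submodule N, N `<=` left_principal a & exists2 c, N (c * a) & c * a <> 0].
Proof.
move=> /exists_maximal_left_multiple[c [_ ca0 maxc]].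
exists [set b * (c * a) | b in [set: R]]; split; first exact: simple_left_principal.
  by move=> _ [b _ <-]; exists (b * c); rewrite ?mulrA.
by exists c => //; exact: (mem_cyclic (c * a : R%:left_mod)).
Qed.

(** * The socles and the singular ideals *)

Lemma essential_left_S : essential_left_ideal S.
Proof.
apply/(essential_left_idealP lS) => x /exists_maximal_left_multiple[c [Sc c0 _]].
by exists c.
Qed.

Lemma right_socle_essential I : right_ideal I ->
  essential_in (socle (I : set R%:right_mod)) (I : set R%:right_mod).
Proof.
move=> rI; apply: socle_essential => // x Ix /exists_simple_right[N [simN Nx [a Na a0]]].
exists N; split=> //; last by exists a.
by apply: subset_trans Nx _ => _ [b _ <-]; apply: right_idealM rI Ix.
Qed.

Lemma left_socle_essential I : left_ideal I ->
  essential_in (socle (I : set R%:left_mod)) (I : set R%:left_mod).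
Proof.
move=> lI; apply: socle_essential => // x Ix /exists_simple_left[N [simN Nx [a Na a0]]].
exists N; split=> //; last by exists a.
by apply: subset_trans Nx _ => _ [b _ <-]; apply: left_idealM lI Ix.
Qed.

Lemma right_socleE : right_socle [set: R] = S.
Proof.
apply/seteqP; split; first exact: (socle_sub_essential essS).
apply: socle_sub_essential_right; apply: right_socle_essential.
exact: (submodule_setT R%:right_mod).
Qed.

(** A nonzero element of a simple right ideal has a maximal right annihilator, so
   that it also generates a simple left ideal. *)
Lemma left_socleE : left_socle [set: R] = S.
Proof.
apply/seteqP; split; first exact: (socle_sub_essential essential_left_S).
rewrite -right_socleE; pose W : set R := left_socle [set: R].
have lW : left_ideal W := submodule_socle (M := R%:left_mod) setT.
suff sub : right_socle [set: R] `<=` [set x | forall r, W (x * r)].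
  by move=> x /sub/(_ 1); rewrite mulr1.
apply: (@socle_min _ R%:right_mod).
  apply: right_idealP => [r|x y Wx Wy r|x a Wx r].
  - by rewrite mul0r; exact: left_ideal0.
  - by rewrite mulrDl; exact: left_idealD lW (Wx r) (Wy r).
  - by rewrite -mulrA; exact: Wx.
move=> N simN _ x Nx r; have rN : @right_ideal R N by case: simN.
have Nxr : N ((x : R) * r) := right_idealM r rN Nx.
have [->|xr0] := pselect ((x : R) * r = 0); first exact: left_ideal0.
have simxr := simple_left_principal (simple_right_maximal simN Nxr xr0).
exact: (simple_sub_socle simxr (@subsetT _ _) (mem_cyclic ((x : R) * r : R%:left_mod))).
Qed.

(** The right annihilator of 1 - z misses S, which is essential. *)
Lemma left_annihilator_socle_unit z : (forall s, S s -> z * s = 0) ->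
  exists c, c * (1 - z) = 1.
Proof.
move=> zS; have [|c cE] := @self_injective_left_multiple (1 - z) 1; last by exists c.
move=> r zr; rewrite mul1r; apply: contrapT => /essSE[a Sra ra0]; apply: ra0.
have : (1 - z) * (r * a) = 0 by rewrite mulrA zr mul0r.
by rewrite mulrBl mul1r (zS _ Sra) subr0.
Qed.

(** For z in the left annihilator of S, the left inverse c of 1 - z is again of the
   form 1 - z', so that it is left invertible as well and 1 - z is a unit. *)
Lemma left_annihilator_socle x : (forall s, S s -> x * s = 0) -> J x.
Proof.
move=> xS; apply: jacobson_sufficient => a; set z := x * a.
have zS s : S s -> z * s = 0.
  by move=> Ss; rewrite /z -mulrA xS //; exact: (left_idealM a lS Ss).
have [c c1] := left_annihilator_socle_unit zS; exists c.
have cE : c = 1 - (- c * z).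
  by rewrite mulNr opprK -[X in X + _]c1 mulrBr mulr1 subrK.
have [|b b1] := @left_annihilator_socle_unit (- c * z).
  by move=> s Ss; rewrite -mulrA zS // mulr0.
have bc : b * c = 1 by rewrite [X in _ * X]cE.
have bz : b = 1 - z by rewrite -[LHS]mulr1 -[X in b * X]c1 mulrA bc mul1r.
by rewrite -bz.
Qed.

Lemma jacobson_right_singular : J = right_singular R.
Proof.
apply/seteqP; split=> x.
  move=> Jx; have rx : right_ideal (right_ann [set x]).
    suff -> : right_ann [set x] = [set r | x * r = 0] by exact: right_ideal_ann.
    by apply/seteqP; split=> r; [apply|move=> xr _ ->].
  apply: (essential_sub rx essS) => // s Ss _ ->; exact: jacobson_mul_socle.
move=> /socle_sub_essential_right Sx; apply: left_annihilator_socle => s /Sx; exact.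
Qed.

(** For a maximal right ideal M, the annihilator of some s, the left ideal Rs is simple
   and so lies in the essential left ideal that kills x; hence x is in M. *)
Lemma jacobson_left_singular : J = left_singular R.
Proof.
have lx x : left_ideal (left_ann [set x]).
  apply: left_idealP => [y _|a b ax bx y xy|a b bx y xy]; first by rewrite mul0r.
    by rewrite mulrDl ax ?bx ?addr0.
  by rewrite -mulrA bx ?mulr0.
apply/seteqP; split=> x.
  move=> Jx; apply: (essential_sub (lx x) essential_left_S) => // s Ss _ ->.
  exact: socle_mul_jacobson.
move=> /(essential_left_idealP (lx x)) essx M maxM.
have [s Ss sM] := maximal_right_annihilator maxM.
have maxs : maximal_right_ideal [set r | s * r = 0].
  by suff -> : [set r | s * r = 0] = M by []; apply/seteqP; split=> r /sM.
apply/sM; have [|c cx cs0] := essx s.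
  by move=> s_eq0; apply: (maximal_not1 maxM); apply/sM; rewrite s_eq0 mul0r.
have /(simple_meet_sub (simple_left_principal maxs) (lx x)) : 
    exists2 y, ([set b * s | b in [set: R]] `&` left_ann [set x]) y & y <> 0.
  by exists (c * s) => //; split=> //; exists c.
by move=> /(_ s (mem_cyclic (s : R%:left_mod)) x); apply.
Qed.

(** * Cogeneration, annihilators and the q-ring property *)

(** Any nonzero cyclic module maps onto a simple one, which embeds in R. *)
Lemma right_module_separated (N : lmodType R^c) (y : N) : y <> 0 ->
  exists g : {linear N -> R%:right_mod}, g y <> 0.
Proof.
move=> y0; pose K : set R := [set a | (a : R^c) *: y = 0].
have rK : right_ideal K by exact: submodule_ann.
have [|M maxM KM] := sub_maximal_right rK; first by rewrite /K /= scale1r.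
have [s Ss sM] := maximal_right_annihilator maxM.
have [a ay|g gE] := @injective_cyclic _ N R%:right_mod y s injR; first exact/sM/KM.
exists g; rewrite gE => s_eq0; apply: (maximal_not1 maxM); apply/sM.
by rewrite [s](s_eq0 : s = 0 :> R) mul0r.
Qed.

Lemma right_cogenerator : cogenerator R%:right_mod.
Proof.
move=> N N' f g [x fgx].
have [|h hE] := @right_module_separated N' (f x - g x).
  by move=> /eqP; rewrite subr_eq0 => /eqP.
by exists h, x => hfg; apply: hE; rewrite linearB hfg subrr.
Qed.

Lemma double_annihilator (T : set R) : right_ideal T -> T = right_ann (left_ann T).
Proof.
move=> rT; apply/seteqP; split=> z; first by move=> Tz a aT; apply: aT.
move=> zT; apply: contrapT => Tz.
pose pi := \pi_(Quotient.quot (submod_pred rT)) : R -> quot_mod rT.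
have pi0 t : pi t = 0 <-> T t.
  rewrite /pi -(raddf0 (\pi_(Quotient.quot (submod_pred rT)))); split=> [/eqP|Tt].
    by rewrite -Quotient.idealrBE subr0 => /set_mem.
  by apply/eqP; rewrite -Quotient.idealrBE subr0; apply/mem_set.
have [|g gz] := @right_module_separated (quot_mod rT) (pi z); first by move/pi0.
have gE r : g (pi r) = (g (pi 1) : R) * r.
  rewrite -[RHS]/((r : R^c) *: g (pi 1)) -linearZZ; congr (g _).
  by rewrite -[in LHS](right_scale1 r); exact/esym/pi_quot_scale.
apply: gz; rewrite gE; apply: zT => t Tt; rewrite -gE.
by move/pi0: Tt => ->; rewrite linear0.
Qed.

(** If K is a complement of the right ideal I, then I + K is two-sided: left
   multiplication by c maps I into I + K, and projecting back gives the required
   endomorphism of I. *)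
Lemma duo_q_ring : right_q_ring R.
Proof.
move=> I rI M i f inji.
have [C [rC IC essC]] := right_ideal_complement rI.
have [lIC _] := duo essC.
have [v vE] : exists v : {linear submod_of rI -> R%:right_mod}, forall u, v u = val u.
  by apply: linear_of => a x y; rewrite linearP.
have [|g gE] := injR (i := v \o i) (v \o f).
  by move=> x y /=; rewrite !vE => /val_inj/inji.
have [|p [pp pC pI]] := injective_separation injR rC rI.
  by move=> x Cx Ix; apply: IC.
have Ip x : I x -> I (p (g x)).
  move=> Ix; have [] : ideal_add I C (g x).
    rewrite right_linear_mul; apply: left_idealM lIC _.
    by exists x => //; exists 0; [exact: right_ideal0|rewrite addr0].
  by move=> y Iy [c Cc ->]; rewrite (linearD p) pI // (pC c) // addr0.
have mI (u : submod_of rI) : p (g (val u)) \in submod_pred rI.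
  by apply/mem_set/Ip; case: u => u /= /set_mem.
have [h hE] : exists h : {linear submod_of rI -> submod_of rI},
    forall u, val (h u) = p (g (val u)).
  have [|h hE] := @linear_of _ _ _ (fun u => Submod (mI u)); last by exists h => u; rewrite hE.
  move=> a u w; apply/val_inj; rewrite [RHS]linearP.
  rewrite -[LHS]/(p (g (val (a *: u + w)))) -[RHS]/(a *: p (g (val u)) + p (g (val w))).
  by rewrite -!vE !linearP.
exists h => x; apply/val_inj; rewrite hE.
have := gE x; rewrite /= !vE => ->; apply: pI.
by case: (f x) => u /= /set_mem.
Qed.

(** * Embeddings of simple modules *)

Lemma simple_right_embeds (N : lmodType R^c) : simple_module N -> embeds N R%:right_mod.
Proof.
move=> simN; have [_ N0 Nmin] := simN.
have [y _ y0] := nonzero_submodule (submodule_setT N) N0.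
have [g gy] := right_module_separated y0; exists g.
have ker0 : [set x | g x = 0] = [set 0].
  have [||//|kT] := Nmin [set x | g x = 0].
  - exact: (submodule_preimage g (submodule_zero _)).
  - by [].
  by case: gy; have : [set x | g x = 0] y by rewrite kT.
move=> x x' gxx'; apply/eqP; rewrite -subr_eq0; apply/eqP.
suff : [set x | g x = 0] (x - x') by rewrite ker0.
by rewrite /= linearB gxx' subrr.
Qed.

(** By the minimum condition on R/J, the annihilator of L in S is already that of
   finitely many elements of L. If it were zero, these elements would have no common
   right annihilator, as S is essential, and by self-injectivity 1 would be in L. *)
Lemma proper_left_ideal_annihilated L : left_ideal L -> ~ L 1 ->
  exists2 u, u <> 0 & forall l, L l -> l * u = 0.
Proof.
move=> lL L1; pose K (F : seq R) : set R := [set r | forall l, l \in F -> l * (s0 * r) = 0].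
pose Fam : set (set R) := [set X | exists2 F : seq R, (forall l, l \in F -> L l) & X = K F].
have [||_ [F FL ->] Kmin] := @semilocal_minimal R slR Fam.
- by exists (K [::]), [::].
- move=> _ [F FL ->]; split.
    apply: right_idealP => [l Fl|r s Kr Ks l Fl|r b Kr l Fl]; first by rewrite !mulr0.
      by rewrite !mulrDr Kr ?Ks ?addr0.
    by rewrite !mulrA -(mulrA l) Kr ?mul0r.
  by move=> j /s0J j0 l _; rewrite j0 mulr0.
have KL r l : K F r -> L l -> l * (s0 * r) = 0.
  move=> KFr Ll; suff KE : K (l :: F) = K F.
    by move: KFr; rewrite -KE; apply; rewrite inE eqxx.
  apply: Kmin.
    by exists (l :: F) => // m; rewrite inE => /predU1P[->//|]; exact: FL.
  by move=> q Kq m Fm; apply: Kq; rewrite inE Fm orbT.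
apply: contrapT => nou; apply: L1; apply: (self_injective_annihilated lL FL) => r Fr.
rewrite mul1r; apply: contrapT => /essSE[a [q _ qE] ra0].
apply: nou; exists (s0 * q); first by rewrite qE.
have KFq : K F q by move=> m Fm; rewrite qE mulrA Fr ?mul0r.
by move=> l Ll; exact: KL KFq Ll.
Qed.

Lemma simple_left_embeds (N : lmodType R) : simple_module N -> embeds N R%:left_mod.
Proof.
move=> simN; have [_ N0 Nmin] := simN.
have [y _ y0] := nonzero_submodule (submodule_setT N) N0.
have cy (z : N) : exists a : R, z = a *: y.
  have [||cyc0|cycT] := Nmin [set a *: y | a in [set: R]]; first exact: submodule_cyclic.
  - by [].
  - by case: y0; have := mem_cyclic y; rewrite [X in X _]cyc0.
  have : [set a *: y | a in [set: R]] z by rewrite cycT.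
  by move=> [a _ <-]; exists a.
have [||u u0 annu] := @proper_left_ideal_annihilated [set a | a *: y = 0].
- exact: submodule_ann.
- by rewrite /= scale1r.
have [g gE] := cyclic_map (M' := R%:left_mod) cy annu.
exists g; have ker0 : [set x | g x = 0] = [set 0].
  have [||//|kT] := Nmin [set x | g x = 0].
  - exact: (submodule_preimage g (submodule_zero _)).
  - by [].
  case: u0; have : [set x | g x = 0] y by rewrite kT.
  by rewrite /= -[y]scale1r gE scale1r.
move=> x x' gxx'; apply/eqP; rewrite -subr_eq0; apply/eqP.
suff : [set x | g x = 0] (x - x') by rewrite ker0.
by rewrite /= linearB gxx' subrr.
Qed.

(** * Goldie dimensions *)

(** Independent right ideals meet S in elements s0 q_n, and the right ideals that s0
   sends into the partial sums would form a strictly ascending chain above J. *)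
Lemma finite_goldie_right : finite_goldie_dim R%:right_mod.
Proof.
move=> [N [sN0 indep]]; have sN i : submodule (N i) := (sN0 i).1.
have /choice[q qP] : forall i, exists q, N i (s0 * q) /\ s0 * q <> 0.
  move=> i; have [x Nx x0] := nonzero_submodule (sN i) (sN0 i).2.
  have [a [q _ qE] xa0] := essSE x0; exists q; rewrite qE; split=> //.
  exact: (submoduleZ (M := R%:right_mod) a (sN i) Nx).
pose A n : set R := [set r | partial_sum N n (s0 * r)].
have [n|j /s0J j0|n r Ar|n An] := @semilocal_acc R slR A.
- exact: right_ideal_preimage (submodule_partial_sum sN n).
- rewrite /A /= j0; exact: submodule0 (submodule_partial_sum sN 0).
- have := partial_sumS Ar (submodule0 (sN n)); rewrite addr0; exact.
apply: (qP n).2; apply: (independent_partial_sum sN indep (qP n).1).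
by apply: An; apply: (mem_partial_sum sN (ltnSn n)); exact: (qP n).1.
Qed.

(** Choose nonzero x_n in S from independent left ideals. The common right annihilators of
   x_0, ..., x_(n-1) are above J, so they become stationary; then x_n kills one of them and
   is a left linear combination of its predecessors. *)
Lemma finite_goldie_left : finite_goldie_dim R%:left_mod.
Proof.
move=> [N [sN0 indep]]; have sN i : submodule (N i) := (sN0 i).1.
have /choice[x xP] : forall i, exists x, [/\ N i x, S x & x <> 0].
  move=> i; have [x Nx x0] := nonzero_submodule (sN i) (sN0 i).2.
  have [a Sax ax0] := (essential_left_idealP lS).1 essential_left_S x x0.
  by exists (a * x); split=> //; exact: (submoduleZ (M := R%:left_mod) a (sN i) Nx).
pose K n : set R := [set r | forall i, (i < n)%N -> x i * r = 0].
have [n|n j Jj i _|n r Kr i ni|n nE] := @semilocal_dcc R slR K.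
- apply: right_idealP => [i _|r s Kr Ks i ni|r b Kr i ni]; first by rewrite mulr0.
    by rewrite mulrDr Kr ?Ks ?addr0.
  by rewrite mulrA Kr ?mul0r.
- have [_ Sx _] := xP i; exact: socle_mul_jacobson Sx Jj.
- by apply: Kr; rewrite ltnS ltnW.
have [Nx _] := xP n; apply; apply: (independent_partial_sum sN indep Nx).
apply: (@self_injective_annihilated [seq x i | i <- iota 0 n]).
- exact: (submodule_partial_sum sN n).
- move=> l /mapP[i]; rewrite mem_iota add0n => /= ni ->.
  by apply: (mem_partial_sum sN ni); have [] := xP i.
move=> r xr; suff /(_ n (ltnSn n)) : K n.+1 r by [].
rewrite nE // => i ni; apply: xr; apply/mapP; exists i => //.
by rewrite mem_iota add0n.
Qed.

(** * The socles of eR and Re *)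

(** Two independent submodules of eR would be separated by an element of the local
   ring eRe, which acts as 0 on one of them and as the identity on the other. *)
Lemma local_right_socle_simple e : local_idempotent e ->
  simple_submodule (socle (right_principal e : set R%:right_mod)).
Proof.
move=> loc; have ee : e * e = e by case: loc.
have [N [simN Ne _]] := exists_simple_right (local_idempotent_neq0 loc).
apply: (simple_socle simN Ne) => L simL Le.
have eM x : right_principal e x -> e * x = x by move=> [r _ <-]; rewrite mulrA ee.
have [LN|//] := simple_disjoint_or_eq simL simN.
have [sL L0 _] := simL; have [sN N0 _] := simN.
have [g [gL gN]] := @injective_glue _ R%:right_mod R%:right_mod L N idfun injR sL sN LN.
pose c : R := g 1.
have cL x : L x -> e * c * e * x = 0.
  by move=> Lx; rewrite -mulrA (eM _ (Le _ Lx)) -mulrA -right_linear_mul gL ?mulr0.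
have cN x : N x -> e * c * e * x = x.
  move=> Nx; rewrite -mulrA (eM _ (Ne _ Nx)) -mulrA -right_linear_mul.
  by rewrite gN //=; exact: eM (Ne _ Nx).
have [[y [_ yc]]|[y [_ yc]]] := local_idempotent_unit c loc.
  have [x Lx []] := nonzero_submodule sL L0.
  by rewrite -[x](eM _ (Le _ Lx)) -yc -mulrA cL ?mulr0.
have [x Nx []] := nonzero_submodule sN N0.
by rewrite -[x](eM _ (Ne _ Nx)) -yc -mulrA mulrBl cN // (eM _ (Ne _ Nx)) subrr mulr0.
Qed.

(** A simple left ideal inside Re is generated by an s whose right annihilator is
   the unique maximal right ideal that contains 1 - e. *)
Lemma local_left_socle_simple e : local_idempotent e ->
  simple_submodule (socle (left_principal e : set R%:left_mod)).
Proof.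
move=> loc; have ee : e * e = e by case: loc.
have eM x : left_principal e x -> x * (1 - e) = 0.
  by move=> [r _ <-]; rewrite mulrBr mulr1 -mulrA ee subrr.
have gen (L : set R%:left_mod) : simple_submodule L -> L `<=` left_principal e ->
    exists s, [/\ L s, s <> 0 & maximal_right_ideal [set r | s * r = 0]].
  move=> [sL L0 _] Le; have [x Lx x0] := nonzero_submodule sL L0.
  have [c [_ cx0 maxc]] := exists_maximal_left_multiple x0.
  by exists (c * x); split=> //; exact: (submoduleZ (M := R%:left_mod) c sL Lx).
have [N [simN Ne _]] := exists_simple_left (local_idempotent_neq0 loc).
apply: (simple_socle simN Ne) => L simL Le.
have [s [Ns s_neq0 maxs]] := gen N simN Ne.
have [t [Lt t_neq0 maxt]] := gen L simL Le.
have st := local_idempotent_maximal loc maxs maxt (eM s (Ne s Ns)) (eM t (Le t Lt)).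
have [|c cE] := @self_injective_left_multiple s t.
  by move=> r sr; suff : [set r | t * r = 0] r by []; rewrite -st.
have [disj|//] := simple_disjoint_or_eq simL simN.
have sN : submodule N by case: simN.
case: t_neq0; apply: disj => //; rewrite cE.
exact: (submoduleZ (M := R%:left_mod) c sN Ns).
Qed.

End SelfInjective.

(** * Semilocal essentially right duo rings with cyclic hulls *)

Theorem corollary2p17 (R : pzRingType)
    (R_semilocal : semilocal R)
    (R_duo : essentially_right_duo R)
    (R_hull : cyclic_injective_hull R%:right_mod)
    (RJ_hull : cyclic_injective_hull (quot_jacobson_right_mod R)) :
  right_pseudo_frobenius R /\
  (* (1) *)
  (jacobson R = right_singular R /\ right_singular R = left_singular R) /\
  (* (2) *)
  right_socle [set: R] = left_socle [set: R] /\
  (* (3) *)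
  (essential_right_ideal (right_socle [set: R]) /\
   essential_left_ideal (left_socle [set: R])) /\
  (* (4) *)
  (forall e : R, local_idempotent e ->
    let eR : set R%:right_mod := right_principal e in
    let Re : set R%:left_mod := left_principal e in
    [/\ simple_submodule (socle eR), simple_submodule (socle Re),
        essential_in (socle eR) eR & essential_in (socle Re) Re]) /\
  (* (5) *)
  (finite_goldie_dim R%:left_mod /\ finite_goldie_dim R%:right_mod) /\
  (* (6) *)
  ((forall S : lmodType R^c, simple_module S -> embeds S R%:right_mod) /\
   (forall S : lmodType R, simple_module S -> embeds S R%:left_mod)) /\
  (* (7) *)
  right_q_ring R /\
  (* (8) *)
  (forall T : set R, right_ideal T -> T = right_ann (left_ann T)).
Proof.
have injR := self_injective_of_cyclic_hull R_semilocal R_hull.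
have [s0 [s0J essS]] :=
  jacobson_annihilator_essential R_semilocal R_duo injR RJ_hull.
have Jr := jacobson_right_singular R_semilocal injR s0J essS R_duo.
have Jl := jacobson_left_singular R_semilocal injR s0J essS R_duo.
have Sr := right_socleE R_semilocal s0J essS.
have Sl := left_socleE R_semilocal injR s0J essS R_duo.
split; first by split=> //; exact: right_cogenerator R_semilocal injR s0J.
split; first by rewrite -Jr -Jl.
split; first by rewrite Sr Sl.
have essl := essential_left_S R_semilocal injR s0J essS R_duo.
split; first by rewrite Sr Sl.
split.
  move=> e loc eR Re; split.
  - exact: local_right_socle_simple loc.
  - exact: local_left_socle_simple loc.
  - exact: right_socle_essential (submodule_cyclic (e : R%:right_mod)).
  - exact: left_socle_essential (submodule_cyclic (e : R%:left_mod)).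
split; first by split; [exact: finite_goldie_left|exact: finite_goldie_right].
split.
  by split=> N simN; [exact: simple_right_embeds|exact: simple_left_embeds].
split; first exact: duo_q_ring.
by move=> T rT; exact: double_annihilator.
Qed.
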